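(* Let $0<\alpha<1$, let $N_\alpha(t)=N_1(\Lambda(Y_\alpha(t)))$, $t\ge 0$, be the fractional non-homogeneous Poisson process, and for a positive integer $n$ let $T_n=\min\{t\in[0,\infty):N_\alpha(t)=n\}$ be its $n$-th event arrival time (epoch). Then the events $\{T_n\le t\}$ and $\{N_\alpha(t)\ge n\}$ coincide, and $$F_{T_n}(t):=\mathbb{P}(T_n\le t)=\mathbb{P}(N_\alpha(t)\ge n)=\sum_{x=n}^\infty f_x^\alpha(t)=\int_0^\infty h_\alpha(t,u)\sum_{x=n}^\infty\frac{\mathrm{e}^{-\Lambda(u)}\Lambda(u)^x}{x!}\,\mathrm{d}u.$$ Moreover, the limit $$C:=\lim_{u\to\infty}\sum_{x=n}^\infty\frac{\mathrm{e}^{-\Lambda(u)}\Lambda(u)^x}{x!}<\infty$$ is finite, with $C=0$ if $\Lambda(u)\to\infty$ as $u\to\infty$, and $$\mathbb{P}(T_n\le t)=C+\int_0^\infty\left(\int_0^u h_\alpha(t,v)\,\mathrm{d}v\right)\lambda(u)\,\mathrm{e}^{-\Lambda(u)}\frac{\Lambda(u)^{n-1}}{(n-1)!}\,\mathrm{d}u.$$ This generalizes the Erlang distribution to the fractional non-homogeneous Poisson process.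
   Context: The intensity is a function $\lambda:[0,\infty)\to[0,\infty)$, and $\Lambda(t)=\int_0^t\lambda(u)\,\mathrm{d}u$ is the cumulative rate function. $N_1=\{N_1(t),t\ge 0\}$ is a homogeneous Poisson process with intensity $1$, independent of $Y_\alpha$. $L_\alpha=\{L_\alpha(t),t\ge 0\}$ is the $\alpha$-stable subordinator with $\mathbb{E}[\exp(-sL_\alpha(t))]=\exp(-ts^\alpha)$, $s\ge 0$. Its inverse is $Y_\alpha(t)=\inf\{u\ge 0: L_\alpha(u)>t\}$, which has density $$h_\alpha(t,x)=\frac{t}{\alpha x^{1+1/\alpha}}\,g_\alpha\!\left(\frac{t}{x^{1/\alpha}}\right),\quad x\ge 0,\ t\ge 0,$$ where $g_\alpha$ is the density of $L_\alpha(1)$. The marginal distributions of $N_\alpha$ are $$f_x^\alpha(t)=\mathbb{P}(N_\alpha(t)=x)=\int_0^\infty\frac{\mathrm{e}^{-\Lambda(u)}\Lambda(u)^x}{x!}h_\alpha(t,u)\,\mathrm{d}u,\quad x=0,1,2,\ldots$$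
   Formalization: Corrected: C=1 (not 0) if Λ(u)→∞; the last formula reads C minus (not plus) the integral and is stated for t>0, since h_α(0,·)=0; the events {T_n≤t} and {N_α(t)≥n} coincide on regular paths (unit jumps of N_1, L_α strictly increasing and unbounded), which are almost sure. *)

(* Defs.v *)
From HB Require Import structures.
From mathcomp Require Import all_boot all_order all_algebra.
From mathcomp Require Import all_classical all_reals all_analysis.
Import Order.TTheory GRing.Theory Num.Theory.
Import numFieldNormedType.Exports.

Set Implicit Arguments.
Unset Strict Implicit.
Unset Printing Implicit Defensive.

Local Open Scope classical_set_scope.
Local Open Scope ring_scope.

(* Throughout, time is indexed by the whole type R and only the values at
   nonnegative times are constrained or used. *)

(* [poisson_pmf] of the library is 1 for every k when the rate is 0, whereas
   the rate is allowed to vanish here and 0 ^+ 0 = 1 gives the right value. *)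
Definition poisson_weight (R : realType) (r : R) (k : nat) : R :=
  expR (- r) * r ^+ k / k`!%:R.

Section independence.
Context d d1 d2 (Omega : measurableType d) (R : realType)
  (P : probability Omega R) (E1 : measurableType d1) (E2 : measurableType d2).

(* Product rule for k random variables; the rule for subfamilies is the case
   where some of the A i are the full set. *)
Definition mutually_independent (k : nat) (X : nat -> Omega -> E1) : Prop :=
  forall A : nat -> set E1, (forall i, measurable (A i)) ->
    P (\bigcap_(i in `I_k) X i @^-1` A i) = (\prod_(i < k) P (X i @^-1` A i))%E.

(* Independence of the sigma-algebras generated by two processes, tested on
   the pi-systems of finite-dimensional cylinders. *)
Definition independent_processes
    (X : R -> Omega -> E1) (Z : R -> Omega -> E2) : Prop :=
  forall (k m : nat) (s t : nat -> R) (A : nat -> set E1) (B : nat -> set E2),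
    (forall i, 0 <= s i) -> (forall j, 0 <= t j) ->
    (forall i, measurable (A i)) -> (forall j, measurable (B j)) ->
    P ((\bigcap_(i in `I_k) X (s i) @^-1` A i) `&`
       (\bigcap_(j in `I_m) Z (t j) @^-1` B j)) =
    (P (\bigcap_(i in `I_k) X (s i) @^-1` A i) *
     P (\bigcap_(j in `I_m) Z (t j) @^-1` B j))%E.

End independence.

Section processes.
Context d (Omega : measurableType d) (R : realType) (P : probability Omega R).

Record unit_poisson_process (N : R -> {RV P >-> nat}) : Prop := {
  poisson_start : forall w, N 0 w = 0%N ;
  poisson_nondecreasing : forall w s t, 0 <= s -> s <= t ->
    (N s w <= N t w)%N ;
  poisson_right_continuous : forall w t, 0 <= t ->
    \forall s \near t^'+, N s w = N t w ;
  poisson_independent_increments : forall (k : nat) (t : nat -> R),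
    0 <= t 0%N -> (forall i, t i <= t i.+1) ->
    mutually_independent P k (fun i w => (N (t i.+1) w - N (t i) w)%N) ;
  poisson_increment_law : forall s t (k : nat), 0 <= s -> s <= t ->
    P [set w | (N t w - N s w)%N = k] = (poisson_weight (t - s) k)%:E }.

Record stable_subordinator (alpha : R) (L : R -> {RV P >-> R}) : Prop := {
  subordinator_start : forall w, L 0 w = 0 ;
  subordinator_nondecreasing : forall w s t, 0 <= s -> s <= t ->
    L s w <= L t w ;
  subordinator_right_continuous : forall w t, 0 <= t ->
    L s w @[s --> t^'+] --> L t w ;
  subordinator_independent_increments : forall (k : nat) (t : nat -> R),
    0 <= t 0%N -> (forall i, t i <= t i.+1) ->
    mutually_independent P k (fun i w => L (t i.+1) w - L (t i) w) ;
  subordinator_stationary_increments : forall s t (A : set R),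
    0 <= s -> 0 <= t -> measurable A ->
    P [set w | A (L (s + t) w - L s w)] = P [set w | A (L t w)] ;
  subordinator_laplace : forall s t, 0 <= s -> 0 <= t ->
    'E_P[fun w => expR (- s * L t w)]%E = (expR (- t * s `^ alpha))%:E }.

Definition is_density_of (X : {RV P >-> R}) (g : R -> R) : Prop :=
  [/\ measurable_fun setT g, forall x, 0 <= g x
    & forall A : set R, measurable A ->
        distribution P X A = (\int[lebesgue_measure]_(x in A) (g x)%:E)%E].

(* [inf] of an unbounded path's empty level set is 0; this only concerns the
   null event on which the path of L is bounded. *)
Definition inverse_subordinator (L : R -> Omega -> R) (t : R) (w : Omega) : R :=
  inf [set u | 0 <= u /\ t < L u w].

(* The typical behaviour of the paths: no two points of N1 at the same time,
   and L strictly increasing to infinity. *)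
Definition regular_paths (N1 : R -> Omega -> nat) (L : R -> Omega -> R)
    (w : Omega) : Prop :=
  [/\ forall t, 0 < t -> exists s, [/\ 0 <= s, s < t & (N1 t w <= (N1 s w).+1)%N],
      forall s t, 0 <= s -> s < t -> L s w < L t w
    & forall x, exists u, 0 <= u /\ x < L u w].

(* Minimum of the times at which N equals n, +oo if there is none. *)
Definition arrival_time (N : R -> Omega -> nat) (n : nat) (w : Omega) : \bar R :=
  xget +oo%E [set t%:E | t in
    [set t | [/\ 0 <= t, N t w = n
               & forall s, 0 <= s -> N s w = n -> t <= s]]].

End processes.

Definition intensity (R : realType) (lam : R -> R) : Prop :=
  (forall u, 0 <= u -> 0 <= lam u) /\
  forall t, 0 <= t -> (lebesgue_measure).-integrable `[0, t] (EFin \o lam).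

Definition cumulative_rate (R : realType) (lam : R -> R) (t : R) : R :=
  \int[lebesgue_measure]_(u in `[0, t]) lam u.

Definition fnpp (T : Type) (R : realType) (lam : R -> R) (N1 : R -> T -> nat)
    (Y : R -> T -> R) (t : R) (w : T) : nat :=
  N1 (cumulative_rate lam (Y t w)) w.

(* Density at x of Y_alpha(t), in terms of the density g of L_alpha(1). *)
Definition inverse_density (R : realType) (alpha : R) (g : R -> R) (t x : R) : R :=
  t / (alpha * x `^ (1 + alpha^-1)) * g (t / x `^ (alpha^-1)).

Definition poisson_tail (R : realType) (lam : R -> R) (n : nat) (u : R) : \bar R :=
  (\sum_(n <= x <oo) (poisson_weight (cumulative_rate lam u) x)%:E)%E.

(* Main.v *)
Require Import Defs.
From HB Require Import structures.
From mathcomp Require Import all_boot all_order all_algebra.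
From mathcomp Require Import all_classical all_reals all_analysis.
From mathcomp Require Import measurable_realfun ring lra.
Import Order.TTheory GRing.Theory Num.Theory.
Import numFieldNormedType.Exports.
Local Open Scope classical_set_scope.
Local Open Scope ring_scope.

(** Write Lam for the cumulative rate, Y for the inverse subordinator, N for
    the time-changed process and T for its n-th arrival time.  The proof
    treats the paths and the distributions separately.

    Paths.  When L is strictly increasing and unbounded, Y (L u) = u
    ([inverse_subordinatorK]), so that Y takes every nonnegative value even
    though L may jump.  As Lam is continuous and N1 climbs by unit steps, N
    cannot exceed n without having been equal to n: the events T <= t and
    n <= N t agree on such paths ([arrival_time_regular]), and almost every
    path is of this kind ([ae_regular_paths]).  On the remaining paths the two
    events may differ, but N is still right-continuous as long as L has not
    stayed below the current level for ever, so T <= t is a countable union of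
    events N q = n and is measurable everywhere ([arrival_time_rat]).

    Distributions.  Let Q u be the probability that a Poisson variable of
    parameter Lam u is at least n.  Independence gives
    P (n <= N t) = E (Q (Y t)) ([fnpp_tail_probability]).  The law of Y t comes
    from the almost sure equality of the events Y t <= b and t < L b and from
    the self-similarity of L: L b and b^(1/alpha) L 1 have the same Laplace
    transform, hence the same law ([laplace_tail], [subordinator_scaling]).
    Substituting x = t v^(-1/alpha) in the density of L 1 produces the density
    h ([expectation_inverse_subordinator]).

    The Erlang-type formula.  Q u is the integral over [0, u] of
    q s = lam s exp (- Lam s) Lam s ^ (n-1) / (n-1)! ([poisson_tail_integral]),
    so C is the integral of q over the half-line, and
    C = Q (Y t) + (the integral of q over [Y t, oo[) for every outcome.  Taking
    expectations and exchanging integrals in the last term gives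
    C = P (T <= t) + (the integral of P (Y t <= u) q u over u >= 0)
    ([fnpp_tail_by_parts]).

    Both substitutions fall outside the reach of calculus: in the first one
    the integrand is a density, which is only measurable, and in the second
    one Lam is only an indefinite integral.  Both follow from one fact of
    measure theory: the image of a weighted measure is determined by its
    values on the rays ]-oo, b]
    ([ge0_integral_change_of_variables], [ge0_integral_lebesgue_image]). *)

Set Implicit Arguments.
Unset Strict Implicit.
Unset Printing Implicit Defensive.

(** * Image measures and changes of variables *)

Section weighted_image.
Context d d' (T : measurableType d) (T' : measurableType d') (R : realType).
Variables (mu : {measure set T -> \bar R}) (D : set T) (phi : T -> T')
  (w : T -> R).
Hypotheses (mD : measurable D) (mphi : measurable_fun setT phi)
  (mw : measurable_fun D w) (w0 : forall x, D x -> 0 <= w x).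

(** The image under [phi] of the restriction to [D] of the measure of density
    [w]. *)
Definition weighted_image (A : set T') : \bar R :=
  (\int[mu]_(x in D `&` phi @^-1` A) (w x)%:E)%E.

Let mpre A : measurable A -> measurable (phi @^-1` A).
Proof. by move=> mA; rewrite -[X in measurable X]setTI; exact: mphi. Qed.

Let mDpre A : measurable A -> measurable (D `&` phi @^-1` A).
Proof. by move=> mA; apply: measurableI => //; exact: mpre. Qed.

Let wi0 : weighted_image set0 = 0%E.
Proof. by rewrite /weighted_image preimage_set0 setI0 integral_set0. Qed.

Let wi_ge0 A : (0 <= weighted_image A)%E.
Proof. by apply: integral_ge0 => x [Dx _]; rewrite lee_fin; exact: w0. Qed.

Let wi_sigma : semi_sigma_additive weighted_image.
Proof.
move=> F mF tF mUF; rewrite /weighted_image preimage_bigcup setI_bigcupr.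
rewrite ge0_integral_bigcup.
- apply: is_cvg_nneseries => n _ _.
  by apply: integral_ge0 => x [Dx _]; rewrite lee_fin; exact: w0.
- by move=> k; exact: mDpre.
- apply/measurable_EFinP; apply: measurable_funS mw => //.
  by rewrite -setI_bigcupr; apply: subIsetl.
- by move=> x; rewrite -setI_bigcupr => -[Dx _]; rewrite lee_fin; exact: w0.
- apply/trivIsetP => i j _ _ ij.
  move/trivIsetP : tF => /(_ i j Logic.I Logic.I ij) Fij.
  rewrite setIACA setIid -preimage_setI Fij preimage_set0 setI0 //.
Qed.

(** The countable additivity of [weighted_image] needs the hypotheses of this
    section, which its definition does not mention; hence a bundled measure
    that agrees with it rather than a canonical instance. *)
Lemma weighted_image_measure :
  {m : {measure set T' -> \bar R} | forall A, m A = weighted_image A}.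
Proof.
pose mx := isMeasure.Build d' T' R weighted_image wi0 wi_ge0 wi_sigma.
pose m : {measure set T' -> \bar R} := HB.pack weighted_image mx.
by exists m.
Qed.

Import HBNNSimple.

(** Both sides are sums over level sets when [q] is simple, and both are
    monotone limits along simple functions in general. *)
Lemma ge0_integral_weighted_image (nu : {measure set T' -> \bar R})
    (q : T' -> \bar R) :
  (forall A, measurable A -> nu A = weighted_image A) ->
  measurable_fun setT q -> (forall y, 0 <= q y)%E ->
  (\int[nu]_y q y = \int[mu]_(x in D) (q (phi x) * (w x)%:E))%E.
Proof.
move=> nuE mq q0.
pose f_ := nnsfun_approx measurableT mq.
have fq y : (EFin \o f_ n) y @[n --> \oo] --> q y.
  by apply: (@cvg_nnsfun_approx _ _ _ setT).
have fnd y : {homo (fun n => (f_ n y)%:E) : m n / (m <= n)%N >-> (m <= n)%E}.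
  by move=> m n mn; rewrite lee_fin; exact/lefP/nd_nnsfun_approx.
transitivity (limn (fun n => \int[nu]_y (f_ n y)%:E)%E).
  rewrite -monotone_convergence//; last 2 first.
  - by move=> n; exact/measurable_EFinP.
  - by move=> n y _; rewrite lee_fin.
  by apply: eq_integral => y _; apply/esym/cvg_lim => //; exact: fq.
transitivity (limn (fun n => \int[mu]_(x in D)
    ((f_ n (phi x))%:E * (w x)%:E))%E); last first.
  rewrite -monotone_convergence//; last 3 first.
  - move=> n; apply: emeasurable_funM => //; last exact/measurable_EFinP.
    apply/measurable_EFinP/(@measurableT_comp _ _ _ _ _ _ (f_ n)) => //.
    exact: measurable_funTS.
  - by move=> n x Dx; rewrite mule_ge0// lee_fin// w0.
  - by move=> x Dx m n mn; rewrite lee_wpmul2r ?lee_fin ?w0// -lee_fin fnd.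
  apply: eq_integral => x /[!inE] Dx; apply/cvg_lim => //.
  apply: cvgeZr => //; exact: fq.
congr (limn _); apply/funext => n.
transitivity (\sum_(k \in range (f_ n)) (k%:E * nu (f_ n @^-1` [set k])))%E.
  by rewrite integralT_nnsfun sintegralE.
transitivity (\int[mu]_(x in D) (\sum_(k \in range (f_ n))
   ((k * \1_(f_ n @^-1` [set k]) (phi x))%:E * (w x)%:E)))%E; last first.
  apply: eq_integral => x _; rewrite [in RHS]fimfunE -fsumEFin//.
  rewrite ge0_mule_fsuml// => i; rewrite nnfun_muleindic_ge0//.
rewrite ge0_integral_fsum//; last 2 first.
- move=> k; apply: emeasurable_funM; last exact/measurable_EFinP.
  apply/measurable_EFinP/measurable_funM => //; apply: measurable_funTS.
  apply: measurableT_comp => //.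
- move=> k x Dx; rewrite mule_ge0// ?lee_fin ?w0//; exact: nnfun_muleindic_ge0.
apply: eq_fsbigr => k kf.
rewrite nuE// /weighted_image.
under [RHS]eq_integral do rewrite EFinM -muleA.
rewrite ge0_integralZl//; last 3 first.
- apply: emeasurable_funM; last exact/measurable_EFinP.
  apply/measurable_EFinP; apply: measurable_funTS.
  apply: measurableT_comp => //.
- by move=> x Dx; rewrite mule_ge0// lee_fin// w0.
- by move: kf; rewrite inE => -[y _ <-]; rewrite lee_fin.
congr (_ * _)%E.
rewrite integral_mkcondr; apply: eq_integral => x _.
rewrite /patch indicE.
have -> : (phi x \in f_ n @^-1` [set k]) =
    (x \in phi @^-1` (f_ n @^-1` [set k])).
  by apply/idP/idP => /[!inE].
by case: ifPn => H; rewrite ?mul1e ?mul0e.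
Qed.

End weighted_image.

Section rays.
Context (R : realType).
Implicit Types m : {measure set R -> \bar R}.

(** The rays are stable under intersection, generate the Borel sets, and cover
    the line by countably many sets of finite measure. *)
Lemma measure_eq_rays m1 m2 :
  (forall b : R, m1 `]-oo, b]%classic = m2 `]-oo, b]%classic) ->
  (forall b : R, m1 `]-oo, b]%classic < +oo)%E ->
  forall A, measurable A -> m1 A = m2 A.
Proof.
move=> m12 fin; pose G := [set `]-oo, b]%classic | b in [set: R]] : set (set R).
apply: (measure_unique G (fun k => `]-oo, k%:R]%classic)).
- rewrite /measurable/=; apply/seteqP; split.
    apply: smallest_sub; first exact: smallest_sigma_algebra.
    move=> _ [[a b] _ <-]/=.
    have -> : `]a, b]%classic = `]-oo, b]%classic `\` `]-oo, a]%classic :> set R.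
      apply/seteqP; split => x /=; rewrite !in_itv/=.
        by move=> /andP[ax xb]; split => //; apply/negP; rewrite -ltNge.
      by move=> [-> /negP]; rewrite -ltNge => ->.
    by apply: (@measurableD _ (g_sigma_algebraType G));
      apply: sub_sigma_algebra; [exists b|exists a].
  apply: smallest_sub; first exact: smallest_sigma_algebra.
  by move=> _ [b _ <-]; exact: measurable_itv.
- move=> _ _ [a _ <-] [b _ <-]; exists (Num.min a b) => //.
  by apply/seteqP; split => x /=; rewrite !in_itv/= le_min => /andP.
- by move=> k; exists k%:R.
- apply/seteqP; split => // x _; exists (Num.bound `|x|) => //=.
  by rewrite in_itv/= (le_trans (ler_norm x))// ltW// archi_boundP.
- by move=> _ [b _ <-].
- by move=> k; exact: fin.
Qed.

End rays.

(** The weighted image and [nu] agree on rays, hence on all Borel sets. *)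
Lemma ge0_integral_change_of_variables d (T : measurableType d) (R : realType)
    (mu : {measure set T -> \bar R}) (D : set T) (phi w : T -> R)
    (nu : {measure set R -> \bar R}) (q : R -> \bar R) :
  measurable D -> measurable_fun setT phi -> measurable_fun D w ->
  (forall x, D x -> 0 <= w x) ->
  (forall b : R, nu `]-oo, b]%classic < +oo)%E ->
  (forall b : R, nu `]-oo, b]%classic =
    \int[mu]_(x in D `&` phi @^-1` `]-oo, b]%classic) (w x)%:E)%E ->
  measurable_fun setT q -> (forall y, 0 <= q y)%E ->
  (\int[nu]_y q y = \int[mu]_(x in D) (q (phi x) * (w x)%:E))%E.
Proof.
move=> mD mphi mw w0 fin nuE mq q0.
apply: ge0_integral_weighted_image => //.
have [m mE] := weighted_image_measure mu mD mphi mw w0.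
move=> A mA; rewrite -mE; apply: measure_eq_rays => // b.
by rewrite mE nuE.
Qed.

(** * Laplace transforms determine tails *)

Lemma measurable_preimageT d d' (T : measurableType d) (T' : measurableType d')
    (f : T -> T') (A : set T') :
  measurable_fun setT f -> measurable A -> measurable (f @^-1` A).
Proof. by move=> mf mA; rewrite -[X in measurable X]setTI; exact: mf. Qed.

Lemma measurable_gt_set d (T : measurableType d) (R : realType) (f : T -> R)
    (x : R) :
  measurable_fun setT f -> measurable [set w | x < f w].
Proof.
move=> mf; rewrite (_ : [set w | _] = f @^-1` `]x, +oo[%classic).
  exact: measurable_preimageT.
by apply/seteqP; split => w /=; rewrite in_itv/= andbT.
Qed.

Lemma measurable_le_set d (T : measurableType d) (R : realType) (f : T -> R)
    (x : R) :
  measurable_fun setT f -> measurable [set w | f w <= x].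
Proof.
move=> mf; rewrite (_ : [set w | _] = ~` [set w | x < f w]).
  by apply: measurableC; exact: measurable_gt_set.
by apply/seteqP; split => w /=; rewrite leNgt => /negP.
Qed.

Section bounded.
Context d (T : measurableType d) (R : realType) (P : probability T R).

Lemma integrable_bounded (f : T -> R) (M : R) :
  measurable_fun setT f -> (forall x, `|f x| <= M) ->
  P.-integrable setT (EFin \o f).
Proof.
move=> mf fM; apply: measurable_bounded_integrable => //.
  by apply: (le_lt_trans (probability_le1 P measurableT)); rewrite ltry.
exists M; split; first exact: num_real.
by move=> y My x _ /=; exact: le_trans (fM x) (ltW My).
Qed.

(** Dominated convergence with a constant as the dominating function, which is
    integrable because the total mass is finite. *)
Lemma bounded_convergence (f_ : (T -> R)^nat) (f : T -> R) (M : R) :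
  (forall n, measurable_fun setT (f_ n)) -> measurable_fun setT f ->
  (forall x, f_ n x @[n --> \oo] --> f x) ->
  (forall n x, `|f_ n x| <= M) ->
  (\int[P]_x (f_ n x)%:E @[n --> \oo] --> \int[P]_x (f x)%:E)%E.
Proof.
move=> mf_ mf f_f fM.
have [] // := @dominated_convergence _ _ _ P _ measurableT
  (fun n => EFin \o f_ n) (EFin \o f) (EFin \o cst M).
- by move=> n; exact/measurable_EFinP.
- exact/measurable_EFinP.
- apply: aeW => x _; apply: cvg_EFin; last exact: f_f.
  exact: nearW.
- exact: finite_measure_integrable_cst.
- by apply: aeW => x n _; rewrite /= lee_fin.
Qed.

Lemma natr_bool_indic (b : T -> bool) :
  (fun w => (b w)%:R) = \1_[set w | b w] :> (T -> R).
Proof.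
apply/funext => w; rewrite indicE.
by have -> : (w \in [set w | b w]) = b w by apply/idP/idP; rewrite inE.
Qed.

Lemma measurable_natr_bool (b : T -> bool) :
  measurable [set w | b w] -> measurable_fun setT (fun w => (b w)%:R : R).
Proof. by move=> mb; rewrite natr_bool_indic; exact: measurable_indic. Qed.

Lemma probability_integral_bool (b : T -> bool) : measurable [set w | b w] ->
  P [set w | b w] = (\int[P]_w ((b w)%:R : R)%:E)%E.
Proof.
move=> mb; transitivity (\int[P]_w (\1_[set w | b w] w)%:E)%E.
  by rewrite integral_indic// setIT.
by rewrite -natr_bool_indic.
Qed.

End bounded.

Section laplace.
Context (R : realType).

Lemma one_sub_exprn_ge (u : R) (k : nat) : 0 <= u -> u <= 1 ->
  1 - k%:R * u <= (1 - u) ^+ k.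
Proof.
move=> u0 u1; elim: k => [|k ih]; first by rewrite expr0 mul0r subr0.
rewrite exprS -natr1.
apply: (@le_trans _ _ ((1 - u) * (1 - k%:R * u))); last first.
  by rewrite ler_wpM2l// subr_ge0.
have : 0 <= k%:R * u * u by rewrite !mulr_ge0.
lra.
Qed.

Lemma one_sub_exprn_le (u : R) (k : nat) : u <= 1 ->
  (1 - u) ^+ k <= expR (- (k%:R * u)).
Proof.
move=> u1; rewrite -mulrN expRM_natl lerXn2r// ?nnegrE ?subr_ge0 ?expR_ge0//.
exact: expR_ge1Dx.
Qed.

(** A polynomial in [expR (- a)], whose expectation is therefore determined by
    the Laplace transform at integers.  The exponent is chosen so that
    exponent * [expR (- m a)] behaves as m exp (m (x - a)): it vanishes in the
    limit when [x < a] and explodes otherwise, the factor m settling the case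
    [a = x]. *)
Definition tail_kernel (x : R) (m : nat) (a : R) : R :=
  (1 - expR (- (m.+1%:R * a))) ^+
    Num.truncn (m.+1%:R * expR (m.+1%:R * x)).

Lemma tail_kernel_ge0 x m a : 0 <= a -> 0 <= tail_kernel x m a.
Proof.
by move=> a0; rewrite exprn_ge0// subr_ge0 expR_le1 oppr_le0 mulr_ge0.
Qed.

Lemma tail_kernel_le1 x m a : 0 <= a -> tail_kernel x m a <= 1.
Proof.
move=> a0; apply: exprn_ile1.
  by rewrite subr_ge0 expR_le1 oppr_le0 mulr_ge0.
by rewrite lerBlDr lerDl expR_ge0.
Qed.

Lemma cvg_harmonicM (c : R) : c / m.+1%:R @[m --> \oo] --> 0.
Proof.
rewrite -[X in _ --> X](mulr0 c); apply: cvgM; first exact: cvg_cst.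
exact: cvg_harmonic.
Qed.

(** Bernoulli's inequality from below when [x < a], and [1 - u <= expR (- u)]
    from above when [a <= x]; both errors are of order 1 / m. *)
Lemma cvg_tail_kernel x a : 0 <= a ->
  tail_kernel x m a @[m --> \oo] --> ((x < a)%R%:R : R).
Proof.
move=> a0; set u := fun m : nat => expR (- (m.+1%:R * a)).
have u1 m : u m <= 1 by rewrite expR_le1 oppr_le0 mulr_ge0.
pose r m := m.+1%:R * expR (m.+1%:R * x) : R.
have r0 m : 0 <= r m by rewrite mulr_ge0// expR_ge0.
have [xa|ax] := ltP x a.
  have da : 0 < a - x by rewrite subr_gt0.
  apply: (@squeeze_cvgr _ _ _ _ (fun m => 1 - (4 / (a - x) ^+ 2) / m.+1%:R)
    (fun=> 1)).
  - near=> m; rewrite tail_kernel_le1// andbT.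
    apply: le_trans (one_sub_exprn_ge _ (expR_ge0 _) (u1 m)).
    rewrite lerD2l lerN2.
    apply: (@le_trans _ _ (r m * u m)).
      by rewrite ler_wpM2r ?expR_ge0// truncn_le.
    rewrite /r /u -mulrA -expRD.
    have -> : m.+1%:R * x - m.+1%:R * a = - (m.+1%:R * (a - x)) by ring.
    rewrite expRN.
    have m0 : 0 < m.+1%:R :> R by [].
    have e0 : 0 < m.+1%:R * (a - x) / 2 by rewrite divr_gt0// mulr_gt0.
    have : (m.+1%:R * (a - x) / 2) ^+ 2 <= expR (m.+1%:R * (a - x)).
      rewrite [X in expR X](_ : _ = 2%:R * (m.+1%:R * (a - x) / 2)); last first.
        by field.
      rewrite expRM_natl lerXn2r// ?nnegrE ?expR_ge0 ?(ltW e0)//.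
      by apply: le_trans (expR_ge1Dx _); rewrite lerDr.
    move=> h; rewrite ler_pdivrMr ?expR_gt0//.
    apply: (@le_trans _ _ (4 / (a - x) ^+ 2 / m.+1%:R *
       (m.+1%:R * (a - x) / 2) ^+ 2)).
      rewrite le_eqVlt; apply/orP; left; apply/eqP; field.
      by rewrite gt_eqF//= gt_eqF.
    by rewrite ler_wpM2l// !divr_ge0// sqr_ge0.
  - rewrite -[X in _ --> X](subr0 1); apply: cvgB; first exact: cvg_cst.
    exact: cvg_harmonicM.
  - exact: cvg_cst.
apply: (@squeeze_cvgr _ _ _ _ (fun=> 0) (fun m => 1 / m.+1%:R)).
- near=> m; rewrite tail_kernel_ge0//=.
  apply: le_trans (one_sub_exprn_le _ (u1 m)) _.
  rewrite div1r expRN lef_pV2 ?posrE ?expR_gt0//.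
  apply: le_trans (expR_ge1Dx _).
  have h : r m < (Num.truncn (r m)).+1%:R := truncnS_gt _.
  have h2 : m.+1%:R <= r m * u m.
    rewrite /r /u -mulrA -expRD -[leLHS]mulr1 ler_wpM2l// -expR0 ler_expR.
    by rewrite -mulrBr mulr_ge0// subr_ge0.
  have h3 : r m * u m <= (Num.truncn (r m)).+1%:R * u m.
    by rewrite ler_wpM2r ?expR_ge0// ltW.
  rewrite -natr1 in h3; have := u1 m; rewrite -/(r m) -/(u m); lra.
- exact: cvg_cst.
- exact: cvg_harmonicM.
Unshelve. all: by end_near. Qed.

Context d (T : measurableType d) (P : probability T R).

Lemma measurable_expRM (s : R) (X : T -> R) : measurable_fun setT X ->
  measurable_fun setT (fun w => expR (- s * X w)).
Proof. by move=> mX; apply: measurableT_comp => //; apply: measurable_funM. Qed.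

(** Induction on the exponent shows that X and Y give the same expectation to
    [expR (- s a) * (1 - expR (- t a)) ^+ k], because passing from [k] to [k.+1]
    subtracts the same expression with [s + t] in place of [s].  In particular
    they do so to [tail_kernel], and bounded convergence concludes. *)
Lemma laplace_tail (X Y : {RV P >-> R}) :
  (forall w, 0 <= X w) -> (forall w, 0 <= Y w) ->
  (forall s : R, 0 <= s ->
    (\int[P]_w (expR (- s * X w))%:E = \int[P]_w (expR (- s * Y w))%:E)%E) ->
  forall x : R, P [set w | x < X w] = P [set w | x < Y w].
Proof.
move=> X0 Y0 XY x.
pose g (s t : R) (k : nat) (a : R) := expR (- s * a) * (1 - expR (- t * a)) ^+ k.
have g01 (s t : R) k (a : R) : 0 <= s -> 0 <= t -> 0 <= a -> `|g s t k a| <= 1.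
  move=> s0 t0 a0.
  have e01 v : 0 <= v -> expR (- v * a) <= 1.
    by move=> v0; rewrite expR_le1 mulNr oppr_le0 mulr_ge0.
  have b0 : 0 <= 1 - expR (- t * a) by rewrite subr_ge0 e01.
  rewrite ger0_norm ?mulr_ge0 ?expR_ge0 ?exprn_ge0//.
  by rewrite mulr_ile1 ?expR_ge0 ?exprn_ge0 ?e01 ?exprn_ile1//
    lerBlDr lerDl expR_ge0.
have mg s t k (Z : T -> R) : measurable_fun setT Z ->
    measurable_fun setT (fun w => g s t k (Z w)).
  move=> mZ; apply: measurable_funM; first exact: measurable_expRM.
  apply: measurable_funX; apply: measurable_funB => //.
  exact: measurable_expRM.
have gE k : forall s t : R, 0 <= s -> 0 <= t ->
    (\int[P]_w (g s t k (X w))%:E = \int[P]_w (g s t k (Y w))%:E)%E.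
  elim: k => [|k ih] s t s0 t0.
    by under eq_integral do rewrite /g expr0 mulr1;
       under [RHS]eq_integral do rewrite /g expr0 mulr1; exact: XY.
  have gS a : g s t k.+1 a = g s t k a - g (s + t) t k a.
    rewrite /g exprS.
    have -> : - (s + t) * a = - s * a + - t * a by ring.
    rewrite expRD; ring.
  have gI (Z : {RV P >-> R}) : (forall w, 0 <= Z w) ->
      (\int[P]_w (g s t k.+1 (Z w))%:E =
       \int[P]_w (g s t k (Z w))%:E - \int[P]_w (g (s + t) t k (Z w))%:E)%E.
    move=> Z0; under eq_integral do rewrite gS EFinB.
    rewrite integralB_EFin//; apply: (@integrable_bounded _ _ _ _ _ 1).
    - exact: mg.
    - by move=> w; exact: g01.
    - exact: mg.
    - by move=> w; apply: g01 => //; exact: addr_ge0.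
  rewrite (gI X X0) (gI Y Y0) (ih s t s0 t0).
  by rewrite (ih _ t (addr_ge0 s0 t0) t0).
have lim (Z : {RV P >-> R}) : (forall w, 0 <= Z w) ->
   (\int[P]_w (tail_kernel x m (Z w))%:E @[m --> \oo] -->
     P [set w | (x < Z w)%R])%E.
  move=> Z0.
  have mZx : measurable [set w | x < Z w] by exact: measurable_gt_set.
  rewrite probability_integral_bool//.
  apply: (@bounded_convergence _ _ _ _ _ _ 1).
  - move=> m; apply: eq_measurable_fun (mg 0 m.+1%:R
      (Num.truncn (m.+1%:R * expR (m.+1%:R * x))) Z _) => // w _.
    by rewrite /g /tail_kernel oppr0 mul0r expR0 mul1r mulNr.
  - exact: measurable_natr_bool.
  - by move=> w; exact: cvg_tail_kernel.
  - by move=> m w; rewrite ger0_norm ?tail_kernel_ge0 ?tail_kernel_le1.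
have kerE m a : tail_kernel x m a =
    g 0 m.+1%:R (Num.truncn (m.+1%:R * expR (m.+1%:R * x))) a.
  by rewrite /g /tail_kernel oppr0 mul0r expR0 mul1r mulNr.
have kerXY : (fun m => \int[P]_w (tail_kernel x m (X w))%:E)%E =
    (fun m => \int[P]_w (tail_kernel x m (Y w))%:E)%E.
  apply/funext => m; under eq_integral do rewrite kerE.
  under [RHS]eq_integral do rewrite kerE.
  exact: (gE _ _ _ (lexx _) (ler0n _ _)).
have := lim X X0; rewrite kerXY => limX.
exact: (cvg_unique _ limX (lim Y Y0)).
Qed.

End laplace.

(** * Sample paths of the time-changed process *)

Section paths.
Context d (Omega : measurableType d) (R : realType).
Variables (w : Omega) (N1 : R -> Omega -> nat) (L : R -> Omega -> R).
Variable (Lam : R -> R).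

Lemma near_right_ex (t : R) (A : R -> Prop) : (\forall s \near t^'+, A s) ->
  exists2 e : R, 0 < e & forall s, t < s -> s < t + e -> A s.
Proof.
rewrite near_withinE => /nbhs_ballP[e/= e0 h]; exists e => // s ts ste.
by apply: h => //; rewrite /ball/= ltr_distlC; apply/andP; split; lra.
Qed.

Local Notation Y := (inverse_subordinator L).
Let S (t : R) : set R := [set u | 0 <= u /\ t < L u w].

Let S_inf t : S t !=set0 -> has_inf (S t).
Proof. by move=> S0; split => //; exists 0 => u []. Qed.

Lemma inverse_subordinator_ge0 t : 0 <= Y t w.
Proof.
have [S0|/set0P S0] := eqVneq (S t) set0.
  by rewrite /inverse_subordinator -/(S t) S0 inf0.
by apply: lb_le_inf => // u [].
Qed.

Lemma inverse_subordinator_le t u : 0 <= u -> t < L u w -> Y t w <= u.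
Proof. by move=> u0 tL; apply: ge_inf => //; exists 0 => v []. Qed.

(** The level set is empty, and the infimum of the empty set is 0. *)
Lemma inverse_subordinator_bounded t :
  (forall u : R, 0 <= u -> L u w <= t) -> Y t w = 0.
Proof.
move=> Lt; rewrite /inverse_subordinator -/(S t) (_ : S t = set0) ?inf0//.
by apply/seteqP; split => // u [u0]; rewrite ltNge Lt.
Qed.

Hypothesis Lmono : forall s t : R, 0 <= s -> s <= t -> L s w <= L t w.

Lemma inverse_subordinator_lt t a :
  S t !=set0 -> Y t w < a -> exists u : R, [/\ 0 <= u, u < a & t < L u w].
Proof. by move=> iS /(inf_lt iS)[u [u0 tu] ua]; exists u. Qed.

Lemma lt_inverse_subordinator t u : 0 <= u -> u < Y t w -> L u w <= t.
Proof.
move=> u0 uY; rewrite leNgt; apply/negP => tL.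
by have := inverse_subordinator_le u0 tL; rewrite leNgt uY.
Qed.

Lemma inverse_subordinator_nondecreasing s t :
  S t !=set0 -> s <= t -> Y s w <= Y t w.
Proof.
move=> St st; apply: lb_le_inf => // u [u0 tu].
by apply: inverse_subordinator_le => //; exact: le_lt_trans tu.
Qed.

Lemma superlevel_nonempty s t : s <= t -> S t !=set0 -> S s !=set0.
Proof.
by move=> st [u [u0 tu]]; exists u; split => //; exact: le_lt_trans tu.
Qed.

Hypothesis N1_0 : N1 0 w = 0%N.
Hypothesis N1mono : forall s t : R, 0 <= s -> s <= t -> (N1 s w <= N1 t w)%N.
Hypothesis N1right :
  forall t : R, 0 <= t -> \forall s \near t^'+, N1 s w = N1 t w.
Hypothesis Lam0 : Lam 0 = 0.
Hypothesis Lam_mono : forall s t : R, s <= t -> Lam s <= Lam t.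
Hypothesis Lam_cont : continuous Lam.

Let N t w := N1 (Lam (Y t w)) w.

Let Lam_ge0 u : 0 <= u -> 0 <= Lam u.
Proof. by move=> u0; rewrite -Lam0 Lam_mono. Qed.

Let N_mono s t : S t !=set0 -> s <= t -> (N s w <= N t w)%N.
Proof.
move=> St st; apply: N1mono; first exact/Lam_ge0/inverse_subordinator_ge0.
exact/Lam_mono/inverse_subordinator_nondecreasing.
Qed.

Let N_S t : (0 < N t w)%N -> S t !=set0.
Proof.
move=> N0; apply/set0P/eqP => S0; move: N0.
rewrite /N /inverse_subordinator -/(S t) S0 inf0 Lam0 N1_0//.
Qed.

(** At a time [s] that L exceeds somewhere, Y is right-continuous whether or not
    L is regular: a point [u] just above [Y s] with [s < L u] bounds Y on the
    whole interval from [s] to [L u]. *)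
Lemma fnpp_path_right_continuous s : S s !=set0 ->
  exists2 e : R, 0 < e & forall s' : R, s <= s' -> s' < s + e -> N s' w = N s w.
Proof.
move=> Ss.
have [e e0 eN] := near_right_ex (N1right (Lam_ge0 (inverse_subordinator_ge0 s))).
have /cvgrPdist_lt/(_ e e0)/nbhs_ballP[dl/= dl0 dlP] := @Lam_cont (Y s w).
have [||u [u0 uY su]] := @inverse_subordinator_lt s (Y s w + dl) => //.
  by rewrite ltrDl.
exists (L u w - s); first by rewrite subr_gt0.
move=> s' ss' s'L.
have s'u : s' < L u w by lra.
have Ys' : Y s w <= Y s' w.
  by apply: inverse_subordinator_nondecreasing => //; exists u.
have Y's : Y s' w <= u by exact: inverse_subordinator_le.
rewrite /N; have := Lam_mono Ys'; rewrite le_eqVlt => /predU1P[->//|lt].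
apply: eN => //.
have : `|Lam (Y s w) - Lam (Y s' w)| < e.
  apply: dlP; rewrite /ball/= ltr_distlC; apply/andP; split; lra.
by rewrite ltr_distlC => /andP[]; lra.
Qed.

(** The minimum in the definition of the arrival time is attained as soon as N
    reaches n: the infimum of the times at which N equals n is one of them by
    right-continuity. *)
Lemma arrival_time_leP n t : (0 < n)%N ->
  (arrival_time N n w <= t%:E)%E =
  `[< exists s : R, [/\ 0 <= s, s <= t & N s w = n] >].
Proof.
move=> n0; apply/idP/asboolP => [|[s [s0 st Nsn]]].
  rewrite /arrival_time; case: xgetP => [y -> [s [s0 Nsn _] <-]|_].
    by rewrite lee_fin => st; exists s.
  by rewrite leye_eq.
pose A : set R := [set s | 0 <= s /\ N s w = n].
have As : A s by [].
have iA : has_inf A by split; [exists s|exists 0 => r []].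
pose s1 := inf A.
have s1_0 : 0 <= s1 by apply: lb_le_inf; [exists s|move=> r []].
have s1_le r : 0 <= r -> N r w = n -> s1 <= r.
  by move=> r0 rn; apply: ge_inf => //; exists 0 => ? [].
have Ss1 : S s1 !=set0.
  by apply: superlevel_nonempty (s1_le _ s0 Nsn) _; apply: N_S; rewrite Nsn.
have Ns1 : N s1 w = n.
  have [e e0 eN] := fnpp_path_right_continuous Ss1.
  have [|r [r0 rn] rs] := @inf_lt _ A (s1 + e) iA.1; first by rewrite ltrDl.
  by rewrite -(eN r)// s1_le.
rewrite /arrival_time (@xget_unique _ _ _ s1%:E).
- by rewrite lee_fin (le_trans (s1_le _ s0 Nsn)).
- by exists s1.
- move=> _ [r [r0 rn rmin] <-]; congr (_%:E).
  by apply/eqP; rewrite eq_le s1_le// rmin.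
Qed.

(** N keeps the value n on an interval to the right of any time at which it takes
    it, and this interval contains a rational unless the time is [t] itself. *)
Lemma arrival_time_rat n t : (0 < n)%N -> 0 <= t ->
  (arrival_time N n w <= t%:E)%E <->
  N t w = n \/ exists q : rat,
    [/\ 0 <= (ratr q : R), ratr q <= t & N (ratr q) w = n].
Proof.
move=> n0 t0; rewrite arrival_time_leP//; split => [/asboolP[s [s0 st Nsn]]|].
  have [ts|st'] := leP t s; first by left; rewrite (_ : t = s)//; lra.
  right; have Ss : S s !=set0 by apply: N_S; rewrite Nsn.
  have [e e0 eN] := fnpp_path_right_continuous Ss.
  have [|q] := @rat_in_itvoo _ s (Num.min t (s + e)).
    by rewrite lt_min st' ltrDl.
  rewrite in_itv/= lt_min => /and3P[sq qt qe]; exists q; split; [lra|lra|].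
  by rewrite eN ?ltW.
by case=> [Ntn|[q [q0 qt Nqn]]]; apply/asboolP; [exists t|exists (ratr q)].
Qed.

(** The first time at which N1 is at least n is attained by right-continuity, is
    positive, and cannot be reached by a jump of more than one unit. *)
Lemma unit_jumps_surjective n r : (0 < n)%N -> 0 <= r -> (n <= N1 r w)%N ->
  (forall t : R, 0 < t ->
    exists s : R, [/\ 0 <= s, s < t & (N1 t w <= (N1 s w).+1)%N]) ->
  exists t : R, [/\ 0 <= t, t <= r & N1 t w = n].
Proof.
move=> n0 r0 nr jump; pose A : set R := [set t | 0 <= t /\ (n <= N1 t w)%N].
have iA : has_inf A by split; [exists r|exists 0 => ? []].
pose t := inf A.
have t0 : 0 <= t by apply: lb_le_inf; [exists r|move=> ? []].
have t_le u : 0 <= u -> (n <= N1 u w)%N -> t <= u.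
  by move=> u0 nu; apply: ge_inf => //; exists 0 => ? [].
have nt : (n <= N1 t w)%N.
  have [e e0 eN] := near_right_ex (N1right t0).
  have [|u [u0 nu] ut] := @inf_lt _ A (t + e) iA.1; first by rewrite ltrDl.
  have [ut'|tu] := leP u t; first by rewrite (leq_trans nu)// N1mono.
  by rewrite -(eN u).
exists t; split => //; first exact: t_le.
have tgt0 : 0 < t.
  rewrite lt_neqAle t0 andbT; apply/eqP => t00.
  by move: nt; rewrite -t00 N1_0 leqNgt n0.
have [s [s0 st jmp]] := jump t tgt0.
apply/eqP; rewrite eqn_leq nt andbT (leq_trans jmp)// ltnNge.
by apply/negP => /(t_le _ s0); rewrite leNgt st.
Qed.

Hypothesis regular : regular_paths N1 L w.

Let S_regular t : S t !=set0.
Proof. by case: regular => _ _ /(_ t)[u]; exists u. Qed.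

(** Strict monotonicity of L makes Y a left inverse, so that Y is onto. *)
Lemma inverse_subordinatorK (u : R) : 0 <= u -> Y (L u w) w = u.
Proof.
case: regular => _ Linc _ u0; apply/eqP; rewrite eq_le; apply/andP; split.
  apply/ler_addgt0Pr => e e0; apply: inverse_subordinator_le; first lra.
  by apply: Linc => //; lra.
apply: lb_le_inf; first exact: S_regular.
move=> v [v0 uv]; rewrite leNgt; apply/negP => vu.
by have := Linc _ _ v0 vu; lra.
Qed.

(** If [n <= N t], then N1 equals n at some [r <= Lam (Y t)]; the intermediate
    value theorem gives [u <= Y t] with [Lam u = r], and N equals n at time
    [L u], which is at most [t] when [u < Y t], and at time [t] when [u = Y t]. *)
Lemma arrival_time_regular n t : (0 < n)%N -> 0 <= t -> L 0 w = 0 ->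
  (arrival_time N n w <= t%:E)%E = (n <= N t w)%N.
Proof.
move=> n0 t0 L0; rewrite arrival_time_leP//; apply/asboolP/idP.
  by move=> [s [s0 st <-]]; exact: N_mono.
move=> nt; have Yt0 := inverse_subordinator_ge0 t.
case: (regular) => jump _ _.
have [r [r0 rt Nr]] := unit_jumps_surjective n0 (Lam_ge0 Yt0) nt jump.
have [rE|rE] := eqVneq r (Lam (Y t w)).
  by exists t; split => //; rewrite /N -rE.
have [||u] := @IVT _ Lam 0 (Y t w) r Yt0.
- exact: continuous_subspaceT.
- by rewrite ge_min le_max Lam0 r0 rt orbT.
rewrite in_itv/= => /andP[u0 uY] Lu.
have uY' : u < Y t w.
  rewrite lt_neqAle uY andbT; apply: contra rE => /eqP <-.
  by rewrite Lu.
exists (L u w); split.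
- by rewrite -L0; exact: Lmono.
- exact: lt_inverse_subordinator.
- by rewrite /N inverse_subordinatorK// Lu.
Qed.

End paths.

(** * Measurability, and evaluation at an independent time *)

Section measurability.
Context d (Omega : measurableType d) (R : realType).
Variables (N1 : R -> Omega -> nat) (L : R -> Omega -> R).

Hypothesis mL : forall t : R, measurable_fun setT (L t).
Hypothesis Lmono : forall w (s t : R), 0 <= s -> s <= t -> L s w <= L t w.

(** [Y t < a] holds either because some rational [q < a] satisfies [t < L q], or
    because L never exceeds [t], which is tested at the integers. *)
Lemma measurable_inverse_subordinator t :
  measurable_fun setT (inverse_subordinator L t).
Proof.
move=> _; apply: (measurability _ (RGenInftyO.measurableE R)) => //.
move=> _ [_ [a ->] <-]; rewrite setTI.
have [a0|a0] := leP a 0.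
  rewrite (_ : _ @^-1` _ = set0)//; apply/seteqP; split => // w /=.
  rewrite in_itv/= ltNge => /negP; apply.
  exact: le_trans a0 (inverse_subordinator_ge0 _ _ _).
rewrite (_ : _ @^-1` _ =
    (\bigcup_(q : rat) [set w | 0 <= (ratr q : R) < a /\ t < L (ratr q) w]) `|`
    (\bigcap_(k : nat) [set w | L k%:R w <= t])).
  apply: measurableU.
    apply: bigcupT_measurable_rat => q.
    have [qa|qa] := boolP (0 <= (ratr q : R) < a).
      rewrite (_ : [set w | _] = [set w | t < L (ratr q) w]).
        exact: measurable_gt_set.
      by apply/seteqP; split => w //= [].
    rewrite (_ : [set w | _] = set0)//.
    by apply/seteqP; split => w //= [].
  apply: bigcapT_measurable => k.
  rewrite (_ : [set w | _] = ~` [set w | t < L k%:R w]).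
    by apply: measurableC; exact: measurable_gt_set.
  by apply/seteqP; split => w /=; rewrite leNgt => /negP.
apply/seteqP; split => w /=; rewrite in_itv/=.
  move=> Ya; have [Lt|] := pselect (forall u : R, 0 <= u -> L u w <= t).
    by right => k _; exact: Lt.
  move=> /existsNP[u /not_implyP[u0 /negP]]; rewrite -ltNge => tu.
  have [||v [v0 va tv]] := @inverse_subordinator_lt _ _ _ w L t a => //.
    by exists u.
  have [q] := rat_in_itvoo va; rewrite in_itv/= => /andP[vq qa].
  left; exists q => //=; split; first by rewrite qa andbT; lra.
  by apply: lt_le_trans tv _; apply: Lmono => //; exact: ltW.
case=> [[q _ [/andP[q0 qa] tq]]|Lt].
  exact: le_lt_trans (inverse_subordinator_le q0 tq) qa.
rewrite inverse_subordinator_bounded// => u u0.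
apply: (@le_trans _ _ (L (Num.bound u)%:R w)); last exact: Lt.
by apply: Lmono => //; rewrite ltW// archi_boundP.
Qed.

Hypothesis mN1 : forall t : R, measurable_fun setT (N1 t).
Hypothesis N1mono :
  forall w (s t : R), 0 <= s -> s <= t -> (N1 s w <= N1 t w)%N.
Hypothesis N1right :
  forall w (t : R), 0 <= t -> \forall s \near t^'+, N1 s w = N1 t w.

(** By right-continuity, N1 at time V is less than m exactly when N1 is less
    than m at some rational time after V. *)
Lemma measurable_path_at (V : Omega -> R) (m : nat) :
  measurable_fun setT V -> (forall w, 0 <= V w) ->
  measurable [set w | (m <= N1 (V w) w)%N].
Proof.
move=> mV V0.
rewrite (_ : [set w | _] = ~` \bigcup_(q : rat)
    ([set w | V w < ratr q] `&` (N1 (ratr q) @^-1` [set k | (k < m)%N]))).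
  apply: measurableC; apply: bigcupT_measurable_rat => q; apply: measurableI.
    rewrite (_ : [set w | _] = [set w | - ratr q < - V w]).
      by apply: measurable_gt_set; exact: measurableT_comp.
    by apply/seteqP; split => w /=; rewrite ltrN2.
  exact: measurable_preimageT.
apply/seteqP; split => w /=.
  move=> mN [q _ [/= Vq]]; apply/negP; rewrite -leqNgt (leq_trans mN)//.
  exact/N1mono/ltW.
move=> h; rewrite leqNgt; apply/negP => Nm; apply: h.
have [e e0 eN] := near_right_ex (N1right w (V0 w)).
have [|q] := @rat_in_itvoo _ (V w) (V w + e); first by rewrite ltrDl.
rewrite in_itv/= => /andP[Vq qe]; exists q => //; split => //=.
by rewrite eN.
Qed.

Lemma measurable_path_at_eq (V : Omega -> R) (m : nat) :
  measurable_fun setT V -> (forall w, 0 <= V w) ->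
  measurable [set w | N1 (V w) w = m].
Proof.
move=> mV V0; rewrite (_ : [set w | _] =
    [set w | (m <= N1 (V w) w)%N] `\` [set w | (m < N1 (V w) w)%N]).
  by apply: measurableD; exact: measurable_path_at.
apply/seteqP; split => w /=; first by move=> ->; rewrite ltnn.
by move=> [mN /negP]; rewrite -leqNgt => Nm; apply/eqP; rewrite eqn_leq Nm.
Qed.

Lemma path_cvg_right w (r : R) (r_ : R^nat) : 0 <= r ->
  (forall k, r < r_ k) -> r_ k @[k --> \oo] --> r ->
  \forall k \near \oo, N1 (r_ k) w = N1 r w.
Proof.
move=> r0 rr_ r_r; have [e e0 eN] := near_right_ex (N1right w r0).
move/cvgrPdist_lt : r_r => /(_ e e0); apply: filterS => k.
by rewrite ltr_distlC => /andP[_ ke]; apply: eN.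
Qed.

Variable P : probability Omega R.

Lemma path_tail_cvg_right n (r : R) (r_ : R^nat) : 0 <= r ->
  (forall k, r < r_ k) -> r_ k @[k --> \oo] --> r ->
  P [set w | (n <= N1 (r_ k) w)%N] @[k --> \oo] --> P [set w | (n <= N1 r w)%N].
Proof.
move=> r0 rr_ r_r.
have mN t : measurable [set w | (n <= N1 t w)%N].
  exact: (@measurable_preimageT _ _ _ _ (N1 t) [set k | (n <= k)%N]).
rewrite [X in _ --> X]probability_integral_bool//.
under eq_fun do rewrite probability_integral_bool//.
apply: (@bounded_convergence _ _ _ _ _ _ 1).
- by move=> k; exact: measurable_natr_bool.
- exact: measurable_natr_bool.
- move=> w; apply: cvg_near_cst.
  by apply: filterS (path_cvg_right w r0 rr_ r_r) => k ->.
- by move=> k w; rewrite normr_nat; case: leq.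
Qed.

(** The strict inequality matters: paths are only right-continuous, so V has to
    be approximated from strictly above. *)
Lemma round_up_cvg (v : R) : 0 <= v ->
  (forall k : nat, v < (Num.truncn (k.+1%:R * v)).+1%:R / k.+1%:R) /\
  (Num.truncn (k.+1%:R * v)).+1%:R / k.+1%:R @[k --> \oo] --> v.
Proof.
move=> v0; have h k : v < (Num.truncn (k.+1%:R * v)).+1%:R / k.+1%:R.
  by rewrite ltr_pdivlMr// mulrC truncnS_gt.
split => //; apply: (@squeeze_cvgr _ _ _ _ (fun=> v) (fun k => v + 1 / k.+1%:R)).
- near=> k; rewrite (ltW (h k))/= ler_pdivrMr// mulrDl div1r mulVf//.
  by rewrite -natr1 lerD2r [v * _]mulrC truncn_le mulr_ge0.
- exact: cvg_cst.
- rewrite -[X in _ --> X]addr0; apply: cvgD; first exact: cvg_cst.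
  exact: cvg_harmonicM.
Unshelve. all: by end_near. Qed.

(** Independence is only known at deterministic times.  The identity holds for
    the rounded up times Vk, which take countably many values; both sides
    converge as k grows, by right-continuity of the paths and bounded
    convergence. *)
Lemma path_at_independent_time (V : Omega -> R) (n : nat) :
  measurable_fun setT V -> (forall w, 0 <= V w) ->
  (forall (r : R) (B : set R), 0 <= r -> measurable B ->
    P ([set w | (n <= N1 r w)%N] `&` V @^-1` B) =
    (P [set w | (n <= N1 r w)%N] * P (V @^-1` B))%E) ->
  P [set w | (n <= N1 (V w) w)%N] =
  (\int[P]_w P [set v | (n <= N1 (V w) v)%N])%E.
Proof.
move=> mV V0 ind.
(* [p] is truncated at 0 to be monotone on the whole line *)
pose p (r : R) : R := fine (P [set v | (n <= N1 (Num.max 0%R r) v)%N]).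
have mN t : measurable [set w | (n <= N1 t w)%N].
  exact: (@measurable_preimageT _ _ _ _ (N1 t) [set k | (n <= k)%N]).
have pE (r : R) : 0 <= r -> (p r)%:E = P [set v | (n <= N1 r v)%N].
  by move=> r0; rewrite /p max_r// fineK// fin_num_measure.
have mp : measurable_fun setT p.
  apply: nondecreasing_measurable => // x y xy; apply: fine_le.
  - exact: fin_num_measure.
  - exact: fin_num_measure.
  - apply: le_measure; rewrite ?inE// => w /= /leq_trans; apply.
    apply: N1mono; first by rewrite le_max lexx.
    by rewrite ge_max !le_max lexx xy orbT.
have p01 r : 0 <= p r <= 1.
  rewrite fine_ge0//= -lee_fin fineK ?fin_num_measure//.
  exact: probability_le1.
pose Vk (k : nat) (w : Omega) : R :=
  (Num.truncn (k.+1%:R * V w)).+1%:R / k.+1%:R.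
have Vk0 k w : 0 <= Vk k w by rewrite divr_ge0.
have mVk k : measurable_fun setT (Vk k).
  pose rd (v : R) : R := (Num.truncn (k.+1%:R * v)).+1%:R / k.+1%:R.
  apply: (@measurableT_comp _ _ _ _ _ _ rd) => //; rewrite /rd.
  apply: nondecreasing_measurable => // x y xy.
  rewrite ler_wpM2r// ler_nat ltnS; apply: le_truncn.
  by rewrite ler_wpM2l.
have VkV w : (forall k, V w < Vk k w) /\ Vk k w @[k --> \oo] --> V w.
  exact: round_up_cvg.
have step k : P [set w | (n <= N1 (Vk k w) w)%N] = (\int[P]_w (p (Vk k w))%:E)%E.
  pose J j := V @^-1` `[j%:R / k.+1%:R, j.+1%:R / k.+1%:R[%classic.
  have mJ j : measurable (J j) by exact: measurable_preimageT.
  have JE j w : J j w <-> Num.truncn (k.+1%:R * V w) = j.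
    rewrite /J/= in_itv/= ler_pdivrMr// ltr_pdivlMr// ![V w * _]mulrC.
    rewrite -truncn_eq ?mulr_ge0//.
    by split => /eqP.
  have Jcover : \bigcup_j J j = setT.
    apply/seteqP; split => // w _.
    by exists (Num.truncn (k.+1%:R * V w)) => //; exact/JE.
  have Jtriv : trivIset setT J.
    by move=> i j _ _ [w [/JE <- /JE <-]].
  rewrite probability_integral_bool; last exact: measurable_path_at.
  rewrite -Jcover ge0_integral_bigcup ?Jcover//; last first.
    by apply/measurable_EFinP/measurable_natr_bool; exact: measurable_path_at.
  rewrite -[in RHS]Jcover ge0_integral_bigcup ?Jcover//; last 2 first.
  - by apply/measurable_EFinP; exact: measurableT_comp.
  - by move=> w _; rewrite lee_fin; case/andP: (p01 (Vk k w)).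
  apply: eq_eseriesr => j _.
  pose r : R := j.+1%:R / k.+1%:R.
  have r0 : 0 <= r by rewrite divr_ge0.
  transitivity (\int[P]_(w in J j) (\1_[set w | (n <= N1 r w)%N] w)%:E)%E.
    apply: eq_integral => w /[!inE] /JE Jw.
    by rewrite -natr_bool_indic /Vk Jw.
  rewrite integral_indic//.
  transitivity ((p r)%:E * P (J j))%E; first by rewrite pE//; exact: ind.
  transitivity (\int[P]_(w in J j) (p r)%:E)%E.
    by rewrite integral_cst.
  by apply: eq_integral => w /[!inE] /JE Jw; rewrite /Vk Jw.
have lhs : P [set w | (n <= N1 (Vk k w) w)%N] @[k --> \oo] -->
    P [set w | (n <= N1 (V w) w)%N].
  have mNV (U : Omega -> R) : measurable_fun setT U -> (forall w, 0 <= U w) ->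
      measurable [set w | (n <= N1 (U w) w)%N] by exact: measurable_path_at.
  rewrite [X in _ --> X]probability_integral_bool//; last exact: mNV.
  under eq_fun => k do
    rewrite (@probability_integral_bool _ _ _ _ _ (mNV _ (mVk k) (Vk0 k))).
  apply: (@bounded_convergence _ _ _ _ _ _ 1).
  - by move=> k; apply: measurable_natr_bool; exact: mNV.
  - by apply: measurable_natr_bool; exact: mNV.
  - move=> w; apply: cvg_near_cst.
    have [lt cv] := VkV w.
    by apply: filterS (path_cvg_right w (V0 w) lt cv) => k ->.
  - by move=> k w; rewrite normr_nat; case: leq.
have rhs : (\int[P]_w (p (Vk k w))%:E @[k --> \oo] --> \int[P]_w (p (V w))%:E)%E.
  apply: (@bounded_convergence _ _ _ _ _ _ 1).
  - by move=> k; exact: measurableT_comp.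
  - exact: measurableT_comp.
  - move=> w; have [lt cv] := VkV w.
    apply: fine_cvg; rewrite pE//.
    under eq_fun do rewrite max_r//.
    exact: path_tail_cvg_right.
  - by move=> k w; case/andP: (p01 (Vk k w)) => ? ?; rewrite ger0_norm.
have seqE : (fun k => P [set w | (n <= N1 (Vk k w) w)%N]) =
    (fun k => \int[P]_w (p (Vk k w))%:E)%E by apply/funext.
rewrite seqE in lhs; rewrite (cvg_unique _ lhs rhs)//.
by apply: eq_integral => w _; rewrite pE.
Qed.

End measurability.

(** * Almost sure regularity of the paths *)

Section almost_sure_regularity.
Context d (Omega : measurableType d) (R : realType) (P : probability Omega R).

Lemma negligible_bigcup_count (I : countType) (F : I -> set Omega) :
  (forall i, P.-negligible (F i)) -> P.-negligible (\bigcup_i F i).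
Proof.
move=> FN; apply: (@negligibleS _ _ _ _
    (\bigcup_k if unpickle k is Some i then F i else set0)).
  by move=> w [i _ Fi]; exists (pickle i) => //; rewrite pickleK.
apply: negligible_bigcup => k; case: unpickle => [i|]; first exact: FN.
exact: negligible_set0.
Qed.

(** The exceptional sets of paths below are covered by measurable sets of
    probability O (1 / k). *)
Lemma negligible_le_harmonic (A : set Omega) (B : (set Omega)^nat) (c : R) :
  (forall k, measurable (B k)) -> (forall k, A `<=` B k) ->
  (forall k, P (B k) <= (c / k.+1%:R)%:E)%E -> P.-negligible A.
Proof.
move=> mB AB PB; exists (\bigcap_k B k); split.
- exact: bigcapT_measurable.
- apply/eqP; rewrite eq_le measure_ge0 andbT.
  have mI : measurable (\bigcap_k B k) by exact: bigcapT_measurable.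
  rewrite -[P _]fineK ?fin_num_measure// lee_fin.
  rewrite -(cvg_lim (@Rhausdorff R) (cvg_harmonicM c)).
  apply: limr_ge; first by apply/cvg_ex; exists 0; exact: cvg_harmonicM.
  apply: nearW => k; rewrite -lee_fin fineK ?fin_num_measure//.
  apply: le_trans (PB k); apply: le_measure; rewrite ?inE//.
  by move=> w; exact.
- by move=> w Aw k _; exact: AB.
Qed.

Lemma probability_le_integral (A : set Omega) (f : Omega -> R) :
  measurable A -> measurable_fun setT f -> (forall w, 0 <= f w) ->
  (forall w, A w -> 1 <= f w) -> (P A <= \int[P]_w (f w)%:E)%E.
Proof.
move=> mA mf f0 f1; rewrite -[leLHS]mul1e -integral_cst//.
rewrite integral_mkcond; apply: ge0_le_integral => //.
- by move=> w _; rewrite patchE; case: ifPn.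
- by apply/(measurable_restrictT _ mA); exact: measurable_cst.
- exact/measurable_EFinP.
- move=> w _; rewrite patchE; case: ifPn => [/[!inE] Aw|_].
    by rewrite lee_fin f1.
  by rewrite lee_fin.
Qed.

Lemma expRN_le_inv (x : R) : 0 < x -> expR (- x) <= x^-1.
Proof.
move=> x0; rewrite expRN lef_pV2 ?posrE ?expR_gt0//.
by apply: le_trans (expR_ge1Dx x); rewrite lerDr.
Qed.

Section poisson.
Variable N1 : R -> {RV P >-> nat}.
Hypothesis hN1 : unit_poisson_process N1.

Let mN1 (t : R) (A : set nat) : measurable [set w | A (N1 t w)].
Proof. exact: (@measurable_preimageT _ _ _ _ (N1 t) A). Qed.

Lemma measurable_increment (s t : R) (A : set nat) :
  measurable [set w | A (N1 t w - N1 s w)%N].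
Proof.
rewrite (_ : [set w | _] = \bigcup_j ([set w | N1 s w = j] `&`
    [set w | A (N1 t w - j)%N])).
  apply: bigcupT_measurable => j; apply: measurableI; first exact: (mN1 s [set j]).
  exact: (mN1 t [set i | A (i - j)%N]).
apply/seteqP; split => w /=; first by move=> h; exists (N1 s w).
by move=> [j _ [/= <-]].
Qed.

(** 1 - exp (- x) (1 + x) <= x^2, because exp (- x) >= 1 - x. *)
Lemma poisson_double_jump (s t : R) : 0 <= s -> s <= t ->
  (P [set w | (1 < N1 t w - N1 s w)%N] <= ((t - s) ^+ 2)%:E)%E.
Proof.
move=> s0 st.
pose A k := [set w | (N1 t w - N1 s w)%N = k].
have mA k : measurable (A k) := measurable_increment s t [set k].
have -> : [set w | (1 < N1 t w - N1 s w)%N] = ~` (A 0%N `|` A 1%N).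
  apply/seteqP; split => w; rewrite /A /=.
    by move=> h [] e; rewrite e in h.
  by move=> /not_orP[]; case: (_ - _)%N => [|[|]].
rewrite probability_setC; last exact: measurableU.
have PA k : P (A k) = (poisson_weight (t - s) k)%:E.
  exact: (poisson_increment_law hN1).
have -> : (P (A 0%N `|` A 1%N) = P (A 0%N) + P (A 1%N))%E.
  apply: measureU => //.
  by apply/seteqP; split => // w [] /=; rewrite /A/= => ->.
rewrite !PA /poisson_weight expr0 expr1 fact0 factS fact0 muln1 !divr1 mulr1.
set a := expR _; change ((1 - (a + a * (t - s)))%:E <= ((t - s) ^+ 2)%:E)%E.
rewrite lee_fin {}/a.
have : 1 - (t - s) <= expR (- (t - s)) by exact: expR_ge1Dx.
have : 0 <= t - s by rewrite subr_ge0.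
set dl := t - s => d0 h.
have : (1 - dl) * (1 + dl) <= expR (- dl) * (1 + dl).
  by rewrite ler_wpM2r// addr_ge0.
lra.
Qed.

(** Cut ]0, M] into k pieces.  A jump of at least two units inside ]0, M] forces
    an increment of at least two over one of the pieces, which has probability
    at most k (M / k)^2. *)
Lemma ae_unit_jumps : \forall w \ae P, forall t : R, 0 < t ->
  exists s : R, [/\ 0 <= s, s < t & (N1 t w <= (N1 s w).+1)%N].
Proof.
pose bad (M : nat) := [set w | exists t : R, [/\ 0 < t, t <= M%:R &
  forall s : R, 0 <= s -> s < t -> ((N1 s w).+1 < N1 t w)%N]].
suff badN M : P.-negligible (bad M).
  apply: negligibleS (negligible_bigcup badN) => w /= /existsNP[t].
  move=> /not_implyP[t0 ht]; exists (Num.bound t) => //; exists t; split => //.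
    by rewrite ltW// archi_boundP// ltW.
  move=> s s0 st; rewrite ltnNge; apply/negP => Nts; apply: ht.
  by exists s.
pose tm (k i : nat) : R := M%:R * i%:R / k.+1%:R.
have tm0 k i : 0 <= tm k i by rewrite divr_ge0// mulr_ge0.
have tmS k i : tm k i.+1 - tm k i = M%:R / k.+1%:R.
  by rewrite /tm -natr1; field; rewrite addrC natr1.
have tmle k i : tm k i <= tm k i.+1 by rewrite -subr_ge0 tmS divr_ge0.
pose J k i := [set w | (1 < N1 (tm k i.+1) w - N1 (tm k i) w)%N].
have mJ k i : measurable (J k i).
  exact: (measurable_increment (tm k i) (tm k i.+1) [set j | (1 < j)%N]).
apply: (@negligible_le_harmonic _ (fun k => \big[setU/set0]_(i < k.+1) J k i)
  (M%:R ^+ 2)).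
- by move=> k; exact: bigsetU_measurable.
- move=> k w [t [t0 tM bt]].
  have tmK : t <= tm k k.+1 by rewrite /tm mulfK.
  have ex : exists j, t <= tm k j by exists k.+1.
  (* the piece containing [t] ends at the first subdivision point after [t] *)
  case: (ex_minnP ex) => -[|j] tj jmin.
    by move: tj; rewrite /tm mulr0 mul0r leNgt t0.
  have jt : tm k j < t.
    by rewrite ltNge; apply/negP => /jmin; rewrite ltnn.
  rewrite -bigcup_mkord; exists j; first exact: jmin tmK.
  rewrite /J /= ltn_subRL addn1; apply: leq_trans (bt _ (tm0 k j) jt) _.
  by apply: (poisson_nondecreasing hN1) => //; exact: ltW.
- move=> k; apply: le_trans (Boole_inequality _ _) _; first by [].
  apply: (@le_trans _ _ (\sum_(i < k.+1) ((M%:R / k.+1%:R) ^+ 2)%:E)%E).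
    apply: lee_sum => i _; rewrite -(tmS k i); exact: poisson_double_jump.
  rewrite sumEFin lee_fin sumr_const card_ord -mulr_natr.
  rewrite le_eqVlt; apply/orP; left; apply/eqP; field.
  by rewrite addrC natr1.
Qed.

End poisson.

Section subordinator.
Variables (alpha : R) (L : R -> {RV P >-> R}).
Hypothesis alpha0 : 0 < alpha.
Hypothesis hL : stable_subordinator alpha L.

Lemma subordinator_ge0 t w : 0 <= t -> 0 <= L t w.
Proof.
move=> t0; rewrite -(subordinator_start hL w).
exact: (subordinator_nondecreasing hL).
Qed.

Lemma subordinator_integral (s t : R) : 0 <= s -> 0 <= t ->
  (\int[P]_w (expR (- s * L t w))%:E = (expR (- t * s `^ alpha))%:E)%E.
Proof.
by move=> s0 t0; rewrite -(subordinator_laplace hL s0 t0) unlock.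
Qed.

(** The probability that [L (t - s)] vanishes is at most its Laplace transform at
    any point, and the transform tends to 0 at infinity. *)
Lemma negligible_subordinator_flat (s t : R) : 0 <= s -> s < t ->
  P.-negligible [set w | L t w <= L s w].
Proof.
move=> s0 st; have ts0 : 0 < t - s by rewrite subr_gt0.
have mS : measurable [set w | L (t - s) w <= 0].
  exact: measurable_le_set.
have mA : measurable [set w | L t w <= L s w].
  rewrite (_ : [set w | _] = [set w | L t w - L s w <= 0]).
    by apply: measurable_le_set; exact: measurable_funB.
  by apply/seteqP; split => w /=; rewrite subr_le0.
apply/negligibleP => //.
transitivity (P [set w | L (t - s) w <= 0]).
  have := subordinator_stationary_increments hL s0 (ltW ts0)
    (measurable_itv `]-oo, (0:R)]).
  rewrite (_ : [set w | _] = [set w | L t w <= L s w]); last first.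
    by apply/seteqP; split => w /=; rewrite in_itv/= subr_le0 addrCA subrr addr0.
  move=> e; apply: etrans e _.
  by congr (P _); apply/seteqP; split => w /=; rewrite in_itv.
apply/negligibleP => //.
apply: (@negligible_le_harmonic _ (fun=> [set w | L (t - s) w <= 0]) (t - s)^-1);
  [by []|by move=> k w|].
(* [sg] is chosen so that its power of exponent [alpha] is [k.+1] *)
move=> k; pose sg : R := k.+1%:R `^ alpha^-1.
apply: (@le_trans _ _ (\int[P]_w (expR (- sg * L (t - s) w))%:E)%E).
  apply: probability_le_integral => //.
  - exact: measurable_expRM.
  - move=> w /= Lw; rewrite -expR0 ler_expR mulNr oppr_ge0.
    by rewrite mulr_ge0_le0// powR_ge0.
rewrite subordinator_integral ?powR_ge0 ?(ltW ts0)// lee_fin.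
rewrite /sg -powRrM mulVf ?gt_eqF// powRr1//.
by rewrite mulNr -invfM; apply: expRN_le_inv; rewrite mulr_gt0.
Qed.

(** A path that is not strictly increasing is constant between two rationals. *)
Lemma ae_subordinator_increasing : \forall w \ae P,
  forall s t : R, 0 <= s -> s < t -> L s w < L t w.
Proof.
pose flat (qr : rat * rat) := [set w | (0 <= (ratr qr.1 : R)) /\
  ((ratr qr.1 : R) < ratr qr.2) /\ L (ratr qr.2) w <= L (ratr qr.1) w].
have flatN qr : P.-negligible (flat qr).
  have [[q0 qr']|h] := pselect ((0 <= (ratr qr.1 : R)) /\
      ((ratr qr.1 : R) < ratr qr.2)).
    by apply: negligibleS (negligible_subordinator_flat q0 qr') => w [_ []].
  by apply: negligibleS (negligible_set0 _) => w [? []] ? _; apply: h.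
have := negligible_bigcup_count flatN.
apply: negligibleS => w /= /existsNP[s /existsNP[t /not_implyP[s0]]].
move=> /not_implyP[st /negP]; rewrite -leNgt => Lts.
have [q] := rat_in_itvoo st; rewrite in_itv/= => /andP[sq qt].
have [r] := rat_in_itvoo qt; rewrite in_itv/= => /andP[qr rt].
exists (q, r) => //; rewrite /flat/=.
have q0 : 0 <= ratr q :> R by lra.
split => //; split => //; apply: (@le_trans _ _ (L t w)).
  by apply: (subordinator_nondecreasing hL) => //; lra.
apply: le_trans Lts _; apply: (subordinator_nondecreasing hL) => //; lra.
Qed.

(** By Markov's inequality for exp (- L k), the event L k <= M has probability
    at most exp (M - k). *)
Lemma ae_subordinator_unbounded : \forall w \ae P,
  forall x : R, exists u : R, 0 <= u /\ x < L u w.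
Proof.
pose bd (M : nat) := [set w | forall u : R, 0 <= u -> L u w <= M%:R].
suff bdN M : P.-negligible (bd M).
  apply: negligibleS (negligible_bigcup bdN) => w /= /existsNP[x hx].
  exists (Num.bound `|x|) => // u u0; rewrite leNgt; apply/negP => Lu.
  apply: hx; exists u; split => //; apply: le_lt_trans Lu.
  by rewrite (le_trans (ler_norm x))// ltW// archi_boundP.
apply: (@negligible_le_harmonic _ (fun k => [set w | L k.+1%:R w <= M%:R])
  (expR M%:R)).
- by move=> k; exact: measurable_le_set.
- by move=> k w; apply.
- move=> k; apply: (@le_trans _ _
      (\int[P]_w (expR M%:R * expR (- 1 * L k.+1%:R w))%:E)%E).
    apply: probability_le_integral.
    - exact: measurable_le_set.
    - by apply: measurable_funM => //; exact: measurable_expRM.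
    - by move=> w; rewrite mulr_ge0// expR_ge0.
    - by move=> w /= Lw; rewrite -expRD -[leLHS]expR0 ler_expR mulN1r subr_ge0.
  under eq_integral do rewrite EFinM.
  rewrite ge0_integralZl//; last first.
    by apply/measurable_EFinP; exact: measurable_expRM.
  rewrite subordinator_integral// powR1 mulr1 -EFinM lee_fin.
  by rewrite ler_wpM2l ?expR_ge0//; exact: expRN_le_inv.
Qed.

End subordinator.

Lemma ae_regular_paths (alpha : R) (N1 : R -> {RV P >-> nat})
    (L : R -> {RV P >-> R}) : 0 < alpha ->
  unit_poisson_process N1 -> stable_subordinator alpha L ->
  \forall w \ae P, regular_paths N1 L w.
Proof.
move=> a0 hN hL; have h1 := ae_unit_jumps hN.
have h2 := ae_subordinator_increasing a0 hL.
have h3 := ae_subordinator_unbounded hL.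
by apply: filterS3 h1 h2 h3 => w ? ? ?; split.
Qed.

End almost_sure_regularity.

(** * Substitution by an inverse power *)

(** The case in which the image measure is the restriction of Lebesgue measure to
    [E], itself seen as a weighted image under the identity. *)
Lemma ge0_integral_lebesgue_image d (T : measurableType d) (R : realType)
    (mu : {measure set T -> \bar R}) (D : set T) (phi w : T -> R)
    (E : set R) (q : R -> \bar R) :
  measurable D -> measurable_fun setT phi -> measurable_fun D w ->
  (forall x, D x -> 0 <= w x) -> measurable E ->
  (forall b : R, lebesgue_measure (E `&` `]-oo, b]%classic) < +oo)%E ->
  (forall b : R, lebesgue_measure (E `&` `]-oo, b]%classic) =
    \int[mu]_(x in D `&` phi @^-1` `]-oo, b]) (w x)%:E)%E ->
  measurable_fun setT q -> (forall y, 0 <= q y)%E ->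
  (\int[lebesgue_measure]_(y in E) q y =
   \int[mu]_(x in D) (q (phi x) * (w x)%:E))%E.
Proof.
move=> mD mphi mw w0 mE fin hE mq q0.
have [m mm] : {m : {measure set R -> \bar R} | forall A : set R,
    m A = weighted_image (@lebesgue_measure R) E id (cst (1:R)) A}.
  by apply: weighted_image_measure.
have mE1 (A : set R) : measurable A -> m A = lebesgue_measure (E `&` A).
  move=> mA; rewrite mm /weighted_image preimage_id.
  rewrite (_ : (fun x => _) = cst 1%:E)// integral_cst ?mul1e//.
  exact: measurableI.
transitivity (\int[m]_y q y)%E.
  have -> : (\int[lebesgue_measure]_(y in E) q y =
      \int[lebesgue_measure]_(y in E) (q (id y) * (cst (1:R) y)%:E))%E.
    by apply: eq_integral => y _; rewrite mule1.
  by apply/esym; apply: ge0_integral_weighted_image.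
apply: ge0_integral_change_of_variables => //.
- by move=> b; rewrite mE1.
- by move=> b; rewrite mE1.
Qed.

Section power_substitution.
Context (R : realType).
Local Notation mu := (@lebesgue_measure R).
Variables (a t : R).
Hypotheses (a0 : 0 < a) (t0 : 0 < t).

Let ane0 : a != 0. Proof. by rewrite gt_eqF. Qed.

Let phi (v : R) := t / v `^ a^-1.
Let wt (v : R) := t / (a * v `^ (1 + a^-1)).

Lemma is_derive_inv_powR (v : R) : 0 < v ->
  is_derive v 1 (fun v => - phi v) (wt v).
Proof.
move=> v0.
have -> : (fun v => - phi v) = (fun v => - t *: (v `^ (- a^-1))).
  by apply/funext => x; rewrite /phi powRN -scaleNr.
have -> : wt v = - t *: (- a^-1 * v `^ (- a^-1 - 1)).
  have -> : - a^-1 - 1 = - (1 + a^-1) by rewrite opprD addrC.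
  rewrite /wt powRN /GRing.scale/=; field.
  by rewrite gt_eqF ?powR_gt0//= gt_eqF.
by apply: is_deriveZ; exact: is_derive1_powR.
Qed.

Lemma continuous_inv_powR (v : R) : 0 < v ->
  {for v, continuous (fun v => - phi v)}.
Proof.
move=> v0; apply: differentiable_continuous.
by apply/derivable1_diffP; have [] := is_derive_inv_powR v0.
Qed.

Lemma continuous_inv_powR_derive (v : R) : 0 < v -> {for v, continuous wt}.
Proof.
move=> v0; have -> : wt = (fun v => t / a *: (v `^ (- (1 + a^-1)))).
  by apply/funext => x; rewrite /wt powRN /GRing.scale/= invfM mulrA.
apply: differentiable_continuous; apply/derivable1_diffP; apply: derivableZ.
by have [] := @is_derive1_powR _ (- (1 + a^-1)) v v0.
Qed.

Lemma integral_inv_powR (x y : R) : 0 < x -> x < y ->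
  (\int[mu]_(v in `[x, y]) (wt v)%:E = (phi x - phi y)%:E)%E.
Proof.
move=> x0 xy.
rewrite (@continuous_FTC2 _ wt (fun v => - phi v))//.
- by rewrite -EFinB opprK addrC.
- apply: continuous_in_subspaceT => v /[!inE]/=; rewrite in_itv/= => /andP[xv _].
  by apply: continuous_inv_powR_derive; exact: lt_le_trans xv.
- split.
  + move=> v; rewrite in_itv/= => /andP[xv _].
    by have [] := is_derive_inv_powR (lt_trans x0 xv).
  + by apply: cvg_at_right_filter; exact: continuous_inv_powR.
  + by apply: cvg_at_left_filter; apply: continuous_inv_powR; exact: lt_trans xy.
- move=> v; rewrite in_itv/= => /andP[xv _]; rewrite derive1E.
  by have [_ ->] := is_derive_inv_powR (lt_trans x0 xv).
Qed.

Lemma inv_powR_le (v b : R) : 0 < v -> 0 < b ->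
  (phi v <= b) = ((t / b) `^ a <= v).
Proof.
move=> v0 b0; rewrite /phi ler_pdivrMr ?powR_gt0// mulrC -ler_pdivrMr//.
have tb : 0 <= t / b by rewrite divr_ge0// ltW.
apply/idP/idP => h.
  rewrite -[leRHS]powRr1 ?(ltW v0)// -(mulVf ane0) powRrM.
  by apply: ge0_ler_powR; rewrite ?nnegrE ?powR_ge0// ltW.
rewrite -[leLHS]powRr1// -(mulfV ane0) powRrM.
by apply: ge0_ler_powR; rewrite ?nnegrE ?powR_ge0// ?invr_ge0 ltW.
Qed.

Lemma inv_powR_inv (b : R) : 0 < b -> phi ((t / b) `^ a) = b.
Proof.
move=> b0; rewrite /phi -powRrM mulfV ?gt_eqF// powRr1; last first.
  by rewrite divr_ge0// ltW.
by rewrite invf_div mulrCA mulfV ?mulr1// gt_eqF.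
Qed.

Lemma measurable_inv_powR : measurable_fun setT phi.
Proof.
have -> : phi = (fun v => t * (v `^ (- a^-1))).
  by apply/funext => x; rewrite /phi powRN.
by apply: measurable_funM => //; exact: measurable_powR.
Qed.

Lemma measurable_inv_powR_derive : measurable_fun setT wt.
Proof.
have -> : wt = (fun v => t / a * (v `^ (- (1 + a^-1)))).
  by apply/funext => x; rewrite /wt powRN invfM mulrA.
by apply: measurable_funM => //; exact: measurable_powR.
Qed.

(** The substitution x = t v^(-1/a) for a measurable integrand.  On the ray
    ]-oo, b] it reduces to the fundamental theorem of calculus between
    (t / b)^a and y; stopping at y keeps the singularity of the weight at 0 out
    of these computations. *)
Lemma ge0_integral_inv_powR (y : R) (q : R -> \bar R) : 0 < y ->
  measurable_fun setT q -> (forall x, 0 <= q x)%E ->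
  (\int[mu]_(x in `]phi y, +oo[) q x =
   \int[mu]_(v in `]0%R, y[) (q (phi v) * (wt v)%:E))%E.
Proof.
move=> y0 mq q0.
have phiy0 : 0 < phi y by rewrite divr_gt0// powR_gt0.
have raysE (b : R) : mu (`]phi y, +oo[%classic `&` `]-oo, b]%classic) =
    (if phi y < b then (b - phi y)%:E else 0%E).
  rewrite (_ : _ `&` _ = `]phi y, b]%classic).
    by rewrite lebesgue_measure_itv/= lte_fin.
  by apply/seteqP; split => x /=; rewrite !in_itv/= andbT => /andP.
apply: ge0_integral_lebesgue_image => //.
- exact: measurable_inv_powR.
- by apply: measurable_funTS; exact: measurable_inv_powR_derive.
- move=> v /=; rewrite in_itv/= => /andP[v0 _].
  by rewrite divr_ge0 ?(ltW t0)// mulr_ge0 ?powR_ge0// ltW.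
- by move=> b; rewrite raysE; case: ifP => _; rewrite ltry.
- move=> b; rewrite raysE; case: ifPn => yb; last first.
    rewrite (_ : _ `&` _ = set0) ?integral_set0//; apply/seteqP; split => // v /=.
    rewrite !in_itv/= => -[/andP[v0 vy]] vb; move: yb; rewrite -leNgt => by'.
    have := le_trans vb by'; rewrite inv_powR_le//.
    have := inv_powR_le y0 phiy0; rewrite lexx => /esym.
    have : (t / phi y) `^ a = y.
      rewrite /phi invf_div mulrCA mulfV ?gt_eqF// mulr1 -powRrM mulVf ?gt_eqF//.
      by rewrite powRr1// ltW.
    by move=> -> _; rewrite leNgt vy.
  have b0 : 0 < b by exact: lt_trans yb.
  set x := (t / b) `^ a.
  have x0 : 0 < x by rewrite powR_gt0// divr_gt0.
  have xy : x < y.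
    rewrite ltNge; apply/negP => yx.
    have : x <= y by rewrite -inv_powR_le// ltW.
    move=> xy; have xE : x = y by apply/eqP; rewrite eq_le xy.
    by have := inv_powR_inv b0; rewrite -/x xE => /eqP; rewrite lt_eqF.
  rewrite (_ : _ `&` _ = `[x, y[%classic); last first.
    apply/seteqP; split => v /=; rewrite !in_itv/=.
      by move=> [/andP[v0 ->]]; rewrite inv_powR_le// => ->.
    move=> /andP[xv ->]; rewrite inv_powR_le//; last exact: lt_le_trans xv.
    by rewrite andbT; split => //; exact: lt_le_trans xv.
  rewrite integral_itv_bndo_bndc; last first.
    apply/measurable_EFinP/measurable_funTS; exact: measurable_inv_powR_derive.
  by rewrite integral_inv_powR// inv_powR_inv.
Qed.

End power_substitution.

(** * The law of the inverse subordinator *)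

Section law_of_inverse_subordinator.
Context d (Omega : measurableType d) (R : realType) (P : probability Omega R).
Variables (alpha : R) (L : R -> {RV P >-> R}) (g : R -> R).
Hypothesis alpha01 : 0 < alpha < 1.
Hypothesis hL : stable_subordinator alpha L.
Hypothesis hg : is_density_of (L 1) g.
Local Notation mu := (@lebesgue_measure R).
Local Notation Y := (inverse_subordinator L).

Let alpha0 : 0 < alpha. Proof. by case/andP: alpha01. Qed.

(** Both variables have Laplace transform s |-> exp (- y s^alpha). *)
Lemma subordinator_scaling (y : R) (A : set R) : 0 < y -> measurable A ->
  P (L y @^-1` A) = P ((fun w => y `^ alpha^-1 * L 1 w) @^-1` A).
Proof.
move=> y0 mA; pose c := y `^ alpha^-1.
pose Z : {RV P >-> R} := cst c \* L 1.
have c0 : 0 <= c by exact: powR_ge0.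
have tailE (x : R) : P [set w | x < L y w] = P [set w | x < Z w].
  apply: laplace_tail => [w|w|s s0].
  - exact: (subordinator_ge0 hL _ (ltW y0)).
  - by rewrite mulr_ge0//; exact: (subordinator_ge0 hL _ ler01).
  - rewrite (subordinator_integral hL)// ?(ltW y0)//.
    have sc0 : 0 <= s * c by rewrite mulr_ge0.
    transitivity (\int[P]_w (expR (- (s * c) * L 1 w))%:E)%E.
      rewrite (subordinator_integral hL)// powRM// -powRrM mulVf ?gt_eqF//.
      by rewrite powRr1 ?(ltW y0)//; congr (expR _)%:E; ring.
    by apply: eq_integral => w _; rewrite /Z/= mulNr mulNr mulrA.
have leE (X : {RV P >-> R}) (b : R) :
    (distribution P X `]-oo, b]%classic = 1 - P [set w | (b < X w)%R])%E.
  rewrite -probability_setC; last exact: measurable_gt_set.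
  rewrite /distribution /pushforward; congr (P _).
  by apply/seteqP; split => w /=; rewrite in_itv/= leNgt => /negP.
have := @measure_eq_rays R (distribution P (L y)) (distribution P Z).
apply => //.
- by move=> b; apply: etrans (leE (L y) b) _; rewrite tailE -leE.
- by move=> b; apply: (le_lt_trans (probability_le1 _ _)) => //; rewrite ltry.
Qed.

Lemma subordinator_no_atom (y x : R) : 0 < y -> P [set w | L y w = x] = 0%E.
Proof.
move=> y0; have [_ _ hgA] := hg.
have c0 : 0 < y `^ alpha^-1 by rewrite powR_gt0.
transitivity (P (L y @^-1` [set x])); first by [].
rewrite subordinator_scaling//.
transitivity (distribution P (L 1) [set x / y `^ alpha^-1]).
  rewrite /distribution /pushforward; congr (P _).
  apply/seteqP; split => w /=.
    by move=> <-; rewrite mulrAC mulfV ?mul1r// gt_eqF.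
  by move=> ->; rewrite mulrCA mulfV ?mulr1// gt_eqF.
by rewrite hgA// integral_set1.
Qed.

Lemma subordinator_tail (t y : R) : 0 < y ->
  P [set w | t < L y w] =
  (\int[mu]_(x in `](t / y `^ alpha^-1)%R, +oo[) (g x)%:E)%E.
Proof.
move=> y0; have [_ _ hgA] := hg.
have c0 : 0 < y `^ alpha^-1 by rewrite powR_gt0.
rewrite -hgA//; transitivity (P (L y @^-1` `]t, +oo[%classic)).
  by congr (P _); apply/seteqP; split => w /=; rewrite in_itv/= andbT.
rewrite subordinator_scaling//; congr (P _).
by apply/seteqP; split => w /=; rewrite !in_itv/= !andbT ltr_pdivrMr// mulrC.
Qed.

Let mL t : measurable_fun setT (L t). Proof. exact: measurable_funP. Qed.

Let Lmono w (s t : R) : 0 <= s -> s <= t -> L s w <= L t w.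
Proof. exact: (subordinator_nondecreasing hL). Qed.

Lemma measurable_inverse_stable_subordinator t : measurable_fun setT (Y t).
Proof. exact: measurable_inverse_subordinator. Qed.

(** L exceeds [t] at points arbitrarily close to [b] from the right. *)
Lemma inverse_subordinator_le_level w (t b : R) : 0 <= b ->
  (exists u : R, 0 <= u /\ t < L u w) -> Y t w <= b -> t <= L b w.
Proof.
move=> b0 hS Yb; rewrite leNgt; apply/negP => Lb.
have := @subordinator_right_continuous _ _ _ _ _ _ hL w b b0.
move=> /cvgrPdist_lt/(_ (t - L b w)); rewrite subr_gt0 => /(_ Lb) nr.
have [e e0 eL] := near_right_ex nr.
have [||u [u0 ub tu]] := @inverse_subordinator_lt _ _ _ w L t (b + e / 2) => //.
  by rewrite (le_lt_trans Yb)// ltrDl divr_gt0.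
have := @Lmono w u (b + e / 2) u0 (ltW ub).
have /(_ _ _)/= := eL (b + e / 2).
rewrite ltr_distlC => h.
have /andP[] : L b w - (t - L b w) < L (b + e / 2) w < L b w + (t - L b w).
  by apply: h; lra.
lra.
Qed.

(** The two events differ only when L is bounded or when [L b = t].  Both are
    null, the second one because [L 0] is 0 and the law of [L b] has no atom for
    [b > 0]. *)
Lemma inverse_subordinator_cdf (t b : R) : 0 < t -> 0 <= b ->
  P [set w | Y t w <= b] = P [set w | t < L b w].
Proof.
move=> t0 b0.
have mA : measurable [set w | Y t w <= b].
  exact/measurable_le_set/measurable_inverse_stable_subordinator.
have mB : measurable [set w | t < L b w] by exact: measurable_gt_set.
have ub := ae_subordinator_unbounded hL.
have natom : \forall w \ae P, L b w <> t.
  have [b00|bgt] := eqVneq b 0.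
    by apply: aeW => w; rewrite b00 (subordinator_start hL); lra.
  have mE : measurable [set w | L b w = t].
    exact: (measurable_preimageT (mL b) (measurable_set1 t)).
  exists [set w | L b w = t]; split => //.
    by apply: subordinator_no_atom; rewrite lt_neqAle eq_sym bgt.
  by move=> w /= /contrapT.
rewrite !probability_integral_bool//; apply: ae_eq_integral => //.
- by apply/measurable_EFinP; exact: measurable_natr_bool.
- by apply/measurable_EFinP; exact: measurable_natr_bool.
- apply: filterS2 ub natom => w ubw nat _.
  suff -> : (Y t w <= b) = (t < L b w) by [].
  apply/idP/idP => [Yb|tL]; last exact: inverse_subordinator_le.
  rewrite lt_neqAle (inverse_subordinator_le_level b0 (ubw t) Yb) andbT.
  by apply/eqP => /esym.
Qed.

Lemma inverse_density_ge0 (t v : R) : 0 <= t ->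
  0 <= inverse_density alpha g t v.
Proof.
move=> t0; have [_ g0 _] := hg.
by rewrite mulr_ge0// divr_ge0// mulr_ge0 ?powR_ge0// ltW.
Qed.

Lemma measurable_inverse_density (t : R) :
  measurable_fun setT (inverse_density alpha g t).
Proof.
have [mg _ _] := hg.
apply: measurable_funM; first exact: measurable_inv_powR_derive.
by apply: (measurableT_comp mg); exact: measurable_inv_powR.
Qed.

Lemma inverse_subordinator_cdf_density (t b : R) : 0 < t -> 0 <= b ->
  P [set w | Y t w <= b] =
  (\int[mu]_(v in `[0%R, b]) (inverse_density alpha g t v)%:E)%E.
Proof.
move=> t0 b0; have [mg g0 _] := hg; rewrite inverse_subordinator_cdf//.
have [bE|bn0] := eqVneq b 0.
  rewrite bE set_itv1 integral_set1 (_ : [set w | _] = set0) ?measure0//.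
  apply/seteqP; split => // w /=; rewrite (subordinator_start hL); lra.
have bgt : 0 < b by rewrite lt_neqAle eq_sym bn0.
rewrite subordinator_tail// ge0_integral_inv_powR//; last exact/measurable_EFinP.
rewrite [RHS]integral_itv_bndoo; last first.
  by apply/measurable_EFinP/measurable_funTS; exact: measurable_inverse_density.
by apply: eq_integral => v _; rewrite -EFinM mulrC.
Qed.

(** The law of Y and the measure of density h agree on rays. *)
Lemma expectation_inverse_subordinator (t : R) (q : R -> \bar R) : 0 < t ->
  measurable_fun setT q -> (forall x, 0 <= q x)%E ->
  (\int[P]_w q (Y t w) =
   \int[mu]_(u in `[0%R, +oo[) ((inverse_density alpha g t u)%:E * q u))%E.
Proof.
move=> t0 mq q0.
have mY := measurable_inverse_stable_subordinator t.
pose YR : {RV P >-> R} := HB.pack (Y t) (isMeasurableFun.Build _ _ _ _ _ mY).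
transitivity (\int[distribution P YR]_y q y)%E.
  by rewrite ge0_integral_distribution.
rewrite (@ge0_integral_change_of_variables _ _ _ mu `[0%R, +oo[%classic id
   (inverse_density alpha g t) (distribution P YR) q)//.
- by apply: eq_integral => u _; rewrite muleC.
- by apply: measurable_funTS; exact: measurable_inverse_density.
- by move=> x _; apply: inverse_density_ge0; exact: ltW.
- by move=> b; apply: (le_lt_trans (probability_le1 _ _)) => //; rewrite ltry.
- move=> b; rewrite preimage_id.
  transitivity (P [set w | Y t w <= b]).
    by congr (P _); apply/seteqP; split => w /=; rewrite in_itv.
  have [b0|b0] := leP 0 b.
    rewrite inverse_subordinator_cdf_density//; congr (integral _ _ _).
    by apply/seteqP; split => x /=; rewrite !in_itv/= ?andbT => /andP.
  rewrite (_ : _ `&` _ = set0).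
    rewrite integral_set0 (_ : [set w | _] = set0) ?measure0//.
    apply/seteqP; split => // w /=; have := inverse_subordinator_ge0 w L t; lra.
  by apply/seteqP; split => // x /= []; rewrite !in_itv/= andbT; lra.
Qed.

End law_of_inverse_subordinator.

(** * Poisson weights *)

Section poisson_weights.
Context (R : realType).
Local Notation mu := (@lebesgue_measure R).
Implicit Types r : R.

Lemma poisson_weight_ge0 r k : 0 <= r -> 0 <= poisson_weight r k.
Proof. by move=> r0; rewrite divr_ge0// mulr_ge0 ?expR_ge0 ?exprn_ge0. Qed.

Lemma poisson_weight_sum r : 0 <= r ->
  (\sum_(0 <= k <oo) (poisson_weight r k)%:E = 1)%E.
Proof.
move=> r0; apply/cvg_lim => //.
have -> : (fun n => \sum_(0 <= k < n) (poisson_weight r k)%:E)%E =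
    EFin \o (fun n => expR (- r) * series (exp_coeff r) n).
  apply/funext => n; rewrite sumEFin; congr (_%:E).
  rewrite /series/= big_distrr/=; apply: eq_bigr => k _.
  by rewrite /poisson_weight mulrA.
apply: cvg_EFin; first exact: nearW.
have -> : (1 : R) = expR (- r) * expR r by rewrite -expRD addNr expR0.
by apply: cvgM; [exact: cvg_cst|exact: is_cvg_series_exp_coeff].
Qed.

Lemma poisson_weight_tail r n : 0 <= r ->
  (\sum_(n <= k <oo) (poisson_weight r k)%:E =
   (1 - \sum_(0 <= k < n) poisson_weight r k)%:E)%E.
Proof.
move=> r0; have := poisson_weight_sum r0.
rewrite (@nneseries_split _ _ 0 n)//; last first.
  by move=> k _; rewrite lee_fin poisson_weight_ge0.
rewrite add0n sumEFin => h.
by rewrite EFinB -[1%:E]h addeAC subee// add0e.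
Qed.

Lemma is_derive_expRN (r : R) :
  is_derive r 1 (fun r => expR (- r)) (- expR (- r)).
Proof.
by rewrite -mulrN1; apply: (@is_derive1_comp _ expR -%R).
Qed.

Lemma is_derive_poisson_weightS n (r : R) :
  is_derive r 1 (fun r => poisson_weight r n.+1)
    (poisson_weight r n - poisson_weight r n.+1).
Proof.
have -> : (fun r : R => poisson_weight r n.+1) =
    (n.+1)`!%:R^-1 *: ((fun r : R => expR (- r)) * ((@id R) ^+ n.+1)).
  by apply/funext => x; rewrite /poisson_weight exprfctE mulrC.
apply: is_derive_eq.
rewrite /GRing.scale/= exprfctE /poisson_weight factS natrM.
have f0 : n`!%:R != 0 :> R by rewrite pnatr_eq0 -lt0n fact_gt0.
have n0 : n.+1%:R != 0 :> R by [].
rewrite exprS; field.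
by rewrite f0 addrC natr1 n0.
Qed.

(** The derivatives of consecutive weights telescope. *)
Lemma is_derive_poisson_cdf n (r : R) :
  is_derive r 1 (fun r => \sum_(0 <= k < n.+1) poisson_weight r k)
    (- poisson_weight r n).
Proof.
elim: n => [|n ih].
  rewrite (_ : (fun _ => _) = (fun r => expR (- r))).
    rewrite /poisson_weight expr0 mulr1 fact0 divr1.
    exact: is_derive_expRN.
  by apply/funext => x; rewrite big_nat1 /poisson_weight expr0 mulr1 fact0 divr1.
rewrite (_ : (fun _ => _) =
    (fun r => \sum_(0 <= k < n.+1) poisson_weight r k) +
    (fun r => poisson_weight r n.+1)); last first.
  by apply/funext => x; rewrite big_nat_recr.
apply: is_derive_eq; first by apply: is_deriveD; exact: is_derive_poisson_weightS.
ring.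
Qed.

Lemma continuous_poisson_weight n : continuous (fun r => poisson_weight r n).
Proof.
move=> r; apply: cvgM; last exact: cvg_cst.
apply: cvgM; first by apply: continuous_comp; [exact: opp_continuous|exact: continuous_expR].
exact: exprn_continuous.
Qed.

Lemma integral_poisson_weight n r : 0 <= r ->
  (\int[mu]_(x in `[0%R, r]) (poisson_weight x n)%:E =
   (1 - \sum_(0 <= k < n.+1) poisson_weight r k)%:E)%E.
Proof.
have S0 : \sum_(0 <= k < n.+1) poisson_weight 0 k = 1 :> R.
  rewrite big_nat_recl// big1 ?addr0 => [|k _].
    by rewrite /poisson_weight expr0 fact0 divr1 oppr0 expR0 mulr1.
  by rewrite /poisson_weight expr0n mulr0 mul0r.
rewrite le_eqVlt => /predU1P[<-|r0].
  by rewrite set_itv1 integral_set1 S0 subrr.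
pose F x := - \sum_(0 <= k < n.+1) poisson_weight x k : R.
have dF (x : R) : is_derive x 1 F (poisson_weight x n).
  by have := is_deriveN (is_derive_poisson_cdf n x); rewrite opprK.
have cF : continuous F.
  move=> x; apply: differentiable_continuous; apply/derivable1_diffP.
  by have [] := dF x.
rewrite (@continuous_FTC2 _ _ F)//.
- by rewrite /F S0 -EFinB opprK addrC.
- exact/continuous_subspaceT/continuous_poisson_weight.
- split.
  + by move=> x _; have [] := dF x.
  + by apply: cvg_at_right_filter; exact: cF.
  + by apply: cvg_at_left_filter; exact: cF.
- by move=> x _; rewrite derive1E; have [_ ->] := dF x.
Qed.

(** exp r >= (r / (k+1))^(k+1), so the weight is at most (k+1)^(k+1) / r. *)
Lemma cvg_poisson_weighty k : poisson_weight r k @[r --> +oo] --> (0 : R).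
Proof.
pose c : R := k.+1%:R ^+ k.+1.
have f0 : 0 < k`!%:R :> R by rewrite ltr0n fact_gt0.
apply: (@squeeze_cvgr _ _ _ _ (fun=> 0) (fun r : R => c * r^-1)).
- near=> r; have r0 : 0 < r by near: r; exact: nbhs_pinfty_gt.
  rewrite poisson_weight_ge0 ?(ltW r0)//= /poisson_weight.
  apply: (@le_trans _ _ (expR (- r) * r ^+ k)).
    rewrite ler_pdivrMr// ler_peMr ?mulr_ge0 ?expR_ge0 ?exprn_ge0 ?(ltW r0)//.
    by rewrite ler1n fact_gt0.
  rewrite expRN mulrC ler_pdivrMr ?expR_gt0// -(ler_pM2l r0) -exprS.
  rewrite mulrA [r * (_ * _)]mulrCA mulfV ?gt_eqF// mulr1.
  have -> : expR r = expR (r / k.+1%:R) ^+ k.+1.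
    by rewrite -expRM_natl mulrCA mulfV ?mulr1.
  rewrite -exprMn lerXn2r// ?nnegrE ?mulr_ge0 ?expR_ge0 ?(ltW r0)//.
  rewrite mulrC -ler_pdivrMr//.
  by apply: le_trans (expR_ge1Dx _); rewrite lerDr.
- exact: cvg_cst.
- rewrite -[X in _ --> X](mulr0 c); apply: cvgM; first exact: cvg_cst.
  apply/gtr0_cvgV0; first by near=> r; near: r; exact: nbhs_pinfty_gt.
  exact: cvg_id.
Unshelve. all: by end_near. Qed.

End poisson_weights.

(** * The cumulative rate *)

Section cumulative_rate.
Context (R : realType) (lam : R -> R).
Hypothesis hlam : intensity lam.
Local Notation mu := (@lebesgue_measure R).
Local Notation Lam := (cumulative_rate lam).

Lemma intensity_ge0 u : 0 <= u -> 0 <= lam u.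
Proof. exact: hlam.1. Qed.

Lemma measurable_intensity : measurable_fun (`[0%R, +oo[%classic : set R) lam.
Proof.
have -> : `[0%R, +oo[%classic = \bigcup_(n : nat) `[0%R, n%:R]%classic :> set R.
  apply/seteqP; split => x /=; last first.
    by move=> [n _] /=; rewrite !in_itv/= => /andP[->].
  rewrite in_itv/= andbT => x0; exists (Num.bound x) => //=.
  by rewrite in_itv/= x0 ltW// archi_boundP.
apply/measurable_fun_bigcup => // n.
have [_ /(_ n%:R (ler0n _ n))/integrableP[mf _]] := hlam.
by move/measurable_EFinP : mf.
Qed.

Lemma cumulative_rateE u : 0 <= u ->
  (\int[mu]_(x in `[0%R, u]) (lam x)%:E = (Lam u)%:E)%E.
Proof.
move=> u0; rewrite /cumulative_rate /Rintegral fineK//.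
by apply: integrable_fin_num => //; exact: hlam.2.
Qed.

Lemma cumulative_rate_le0 u : u <= 0 -> Lam u = 0.
Proof.
rewrite le_eqVlt => /predU1P[->|u0].
  by rewrite /cumulative_rate /Rintegral set_itv1 integral_set1.
rewrite /cumulative_rate /Rintegral set_itv_ge ?integral_set0//.
by rewrite bnd_simp -ltNge.
Qed.

Lemma cumulative_rate_nondecreasing s t : s <= t -> Lam s <= Lam t.
Proof.
move=> st; have [s0|s0] := leP s 0.
  rewrite (cumulative_rate_le0 s0) fine_ge0// integral_ge0// => x /=.
  by rewrite in_itv/= => /andP[x0 _]; rewrite lee_fin intensity_ge0.
have t0 : 0 <= t by exact: le_trans (ltW s0) st.
rewrite -lee_fin -!cumulative_rateE ?(ltW s0)//.
apply: ge0_subset_integral => //=.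
- apply/measurable_EFinP; apply: measurable_funS measurable_intensity => //.
  by move=> x /=; rewrite !in_itv/= => /andP[->].
- by move=> x; rewrite in_itv/= => /andP[x0 _]; rewrite lee_fin intensity_ge0.
- by move=> x /=; rewrite !in_itv/= => /andP[-> /le_trans]; apply.
Qed.

Lemma cumulative_rate_ge0 u : 0 <= Lam u.
Proof.
have [u0|u0] := leP u 0; first by rewrite cumulative_rate_le0.
by rewrite -(cumulative_rate_le0 (lexx 0)) cumulative_rate_nondecreasing// ltW.
Qed.

(** The two-sided continuity at 0 and the vanishing of Lam on the negative
    half-line are dealt with by extending the intensity by 0 and integrating
    from a negative point [a]. *)
Lemma continuous_cumulative_rate : continuous Lam.
Proof.
move=> x; pose a := - (`|x| + 1); pose b := `|x| + 1.
have ax : a < x by rewrite /a; have := lerNnormlW (lexx `|x|); lra.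
have xb : x < b by rewrite /b; have := ler_norm x; lra.
have b0 : 0 <= b by rewrite addr_ge0.
have a0 : a < 0 by rewrite oppr_lt0 ltr_wpDl.
pose lam0 := lam \_ `[0%R, +oo[.
have abE u : (`[a, u] `&` `[0%R, +oo[ = `[0%R, u])%classic.
  apply/seteqP; split => y /=; rewrite !in_itv/= ?andbT.
    by move=> [/andP[_ ->] ->].
  by move=> /andP[y0 ->]; rewrite y0 andbT; split => //; lra.
have LamE u : Lam u = \int[mu]_(y in `[a, u]) lam0 y.
  by rewrite /lam0 -Rintegral_mkcondr abE.
have ilam0 : mu.-integrable `[a, b] (EFin \o lam0).
  rewrite -restrict_EFin; apply/integrable_restrict => //.
  by rewrite abE; exact: hlam.2.
have ab := lt_trans ax xb.
have /(continuous_within_itvP _ ab)[cf _ _] :=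
  parameterized_integral_continuous (ltW ab) ilam0.
rewrite (_ : cumulative_rate lam = (fun u => parameterized_integral mu a u lam0)).
  by apply: cf; rewrite in_itv/= ax xb.
by apply/funext => u; rewrite LamE.
Qed.

(** Lam may be flat, so [d] is the last point of its level set. *)
Lemma cumulative_rate_sublevel (u b : R) : 0 <= u -> 0 <= b -> b < Lam u ->
  exists d : R, [/\ 0 <= d, d <= u, Lam d = b &
    forall s, 0 <= s -> s <= u -> (Lam s <= b) = (s <= d)].
Proof.
move=> u0 b0 bu; have L0 := cumulative_rate_le0 (lexx 0).
pose S : set R := [set s | 0 <= s /\ s <= u /\ Lam s <= b].
have S0 : S 0 by split => //; split => //; rewrite L0.
have Su : has_sup S by split; [exists 0|exists u => s [_ []]].
pose d := sup S.
have d0 : 0 <= d by apply: sup_ubound => //; exact: Su.2.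
have du : d <= u by apply: sup_le_ub; [exists 0|move=> s [_ []]].
have sd s : S s -> s <= d by move=> Ss; apply: sup_ubound => //; exact: Su.2.
have Ld : Lam d <= b.
  rewrite leNgt; apply/negP => bd.
  have := @continuous_cumulative_rate d.
  move=> /cvgrPdist_lt/(_ (Lam d - b)); rewrite subr_gt0 => /(_ bd).
  move=> /nbhs_ballP[e/= e0 he].
  have [s Ss ds] := sup_adherent e0 Su.
  have := sd s Ss => sled.
  have : `|Lam d - Lam s| < Lam d - b.
    by apply: he; rewrite /ball/= ger0_norm ?subr_ge0//; rewrite -/d in ds; lra.
  rewrite ger0_norm ?subr_ge0 ?cumulative_rate_nondecreasing//.
  by case: Ss => _ [_]; lra.
have [||c] := @IVT _ Lam 0 u b u0.
- exact/continuous_subspaceT/continuous_cumulative_rate.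
- by rewrite ge_min le_max L0 b0 (ltW bu) orbT.
rewrite in_itv/= => /andP[c0 cu] Lc.
have cd : c <= d by apply: sd; split => //; split => //; rewrite Lc.
have LdE : Lam d = b.
  by apply/eqP; rewrite eq_le Ld -Lc cumulative_rate_nondecreasing.
exists d; split => // s s0 su; apply/idP/idP => [sb|sd'].
  by apply: sd.
by rewrite -LdE cumulative_rate_nondecreasing.
Qed.

(** The substitution r = Lam s, although Lam need not be differentiable: the
    sublevel sets of Lam in [0, u] are intervals [0, d], on which the intensity
    has integral [Lam d]. *)
Lemma ge0_integral_cumulative_rate (u : R) (q : R -> \bar R) : 0 <= u ->
  measurable_fun setT q -> (forall x, 0 <= q x)%E ->
  (\int[mu]_(r in `[0%R, Lam u]) q r =
   \int[mu]_(s in `[0%R, u]) (q (Lam s) * (lam s)%:E))%E.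
Proof.
move=> u0 mq q0; have Lu0 := cumulative_rate_ge0 u.
have rayE (b : R) : (`[0, Lam u] `&` `]-oo, b] = `[0, Num.min (Lam u) b])%classic.
  apply/seteqP; split => x /=; rewrite !in_itv/= le_min.
    by move=> [/andP[-> ->]].
  by move=> /andP[-> /andP[-> ->]].
have msub (D : set R) : measurable D -> D `<=` `[0%R, +oo[%classic ->
    measurable_fun D lam.
  by move=> mD sub; apply: measurable_funS measurable_intensity.
apply: ge0_integral_lebesgue_image => //.
- apply: continuous_measurable_fun; exact: continuous_cumulative_rate.
- by apply: msub => // x /=; rewrite !in_itv/= => /andP[->].
- by move=> x /=; rewrite in_itv/= => /andP[x0 _]; exact: intensity_ge0.
- move=> b; rewrite rayE lebesgue_measure_itv/=; case: ifP => _; rewrite -?EFinB ltry//.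
- move=> b; rewrite rayE lebesgue_measure_itv/= lte_fin.
  have [b0|b0] := ltP b 0.
    rewrite ifF; last by apply/negP; rewrite lt_min; lra.
    rewrite (_ : _ `&` _ = set0) ?integral_set0//.
    apply/seteqP; split => // s /= [_]; rewrite in_itv/=.
    have := cumulative_rate_ge0 s; lra.
  have [bu|ub] := ltP b (Lam u).
    have [d [d0 du Ld hd]] := cumulative_rate_sublevel u0 b0 bu.
    rewrite (_ : _ `&` _ = `[0, d]%classic); last first.
      apply/seteqP; split => s /=; rewrite !in_itv/=.
        by move=> [/andP[s0 su]]; rewrite hd// s0.
      move=> /andP[s0 sd]; have su := le_trans sd du.
      by rewrite s0 su hd.
    rewrite cumulative_rateE// Ld; case: ifPn => [_|]; first by rewrite -EFinB subr0.
    by rewrite -leNgt => b0'; congr EFin; lra.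
  rewrite (_ : _ `&` _ = `[0, u]%classic); last first.
    apply/seteqP; split => s /=; rewrite !in_itv/=; first by case.
    move=> /andP[s0 su]; rewrite s0 su; split => //.
    exact: le_trans (cumulative_rate_nondecreasing su) ub.
  rewrite cumulative_rateE//; case: ifPn => [_|]; first by rewrite -EFinB subr0.
  by rewrite -leNgt => b0'; congr EFin; lra.
Qed.

End cumulative_rate.

(** * The Poisson tail as a function of time *)

Section poisson_tail.
Context (R : realType) (lam : R -> R) (n : nat).
Hypothesis hlam : intensity lam.
Hypothesis n0 : (0 < n)%N.
Local Notation mu := (@lebesgue_measure R).
Local Notation Lam := (cumulative_rate lam).

Lemma measurable_cumulative_rate : measurable_fun setT Lam.
Proof.
by apply: continuous_measurable_fun; exact: continuous_cumulative_rate.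
Qed.

Lemma measurable_poisson_weight k :
  measurable_fun setT (fun r : R => poisson_weight r k).
Proof.
by apply: continuous_measurable_fun; exact: continuous_poisson_weight.
Qed.

Lemma measurable_poisson_weight_rate k :
  measurable_fun setT (fun u => poisson_weight (Lam u) k).
Proof.
apply: (measurableT_comp (measurable_poisson_weight k)).
exact: measurable_cumulative_rate.
Qed.

(** The derivative of [poisson_tail lam n] at almost every point. *)
Definition tail_density (u : R) : R :=
  lam u * expR (- Lam u) * Lam u ^+ n.-1 / (n.-1)`!%:R.

Lemma tail_densityE u : tail_density u = poisson_weight (Lam u) n.-1 * lam u.
Proof. rewrite /tail_density /poisson_weight; ring. Qed.

Lemma tail_density_ge0 u : 0 <= u -> 0 <= tail_density u.
Proof.
move=> u0; rewrite tail_densityE mulr_ge0 ?(intensity_ge0 hlam)//.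
by rewrite poisson_weight_ge0// cumulative_rate_ge0.
Qed.

Lemma measurable_tail_density :
  measurable_fun (`[0%R, +oo[%classic : set R) tail_density.
Proof.
have -> : tail_density = (fun u => poisson_weight (Lam u) n.-1 * lam u).
  by apply/funext => u; exact: tail_densityE.
apply: measurable_funM; last exact: measurable_intensity.
by apply: measurable_funTS; exact: measurable_poisson_weight_rate.
Qed.

Lemma poisson_tailE u : poisson_tail lam n u =
  (1 - \sum_(0 <= k < n) poisson_weight (Lam u) k)%:E.
Proof. by rewrite /poisson_tail poisson_weight_tail// cumulative_rate_ge0. Qed.

Lemma poisson_tail_ge0 u : (0 <= poisson_tail lam n u)%E.
Proof.
apply: nneseries_ge0 => k _ _; rewrite lee_fin poisson_weight_ge0//.
exact: cumulative_rate_ge0.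
Qed.

Lemma measurable_poisson_tail : measurable_fun setT (poisson_tail lam n).
Proof.
rewrite (_ : poisson_tail lam n =
  EFin \o (fun u => 1 - \sum_(0 <= k < n) poisson_weight (Lam u) k)); last first.
  by apply/funext => u; rewrite poisson_tailE.
apply/measurable_EFinP/measurable_funB => //.
by apply: measurable_sum => k; exact: measurable_poisson_weight_rate.
Qed.

(** The Poisson tail at a parameter r is the integral of the weight of order n-1
    over [0, r], and r = Lam u.  The absolute value in [q] makes the integrand
    nonnegative on the whole line. *)
Lemma poisson_tail_integral u : 0 <= u ->
  poisson_tail lam n u = (\int[mu]_(s in `[0%R, u]) (tail_density s)%:E)%E.
Proof.
move=> u0; have Lu0 := cumulative_rate_ge0 hlam u.
rewrite poisson_tailE -[in LHS](prednK n0) -integral_poisson_weight//.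
pose q (r : R) := (poisson_weight `|r| n.-1)%:E.
transitivity (\int[mu]_(r in `[0%R, Lam u]) q r)%E.
  apply: eq_integral => r; rewrite inE/= in_itv/= => /andP[r0 _].
  by rewrite /q ger0_norm.
rewrite ge0_integral_cumulative_rate//.
- apply: eq_integral => s _; rewrite /q ger0_norm ?cumulative_rate_ge0//.
  by rewrite tail_densityE.
- apply/measurable_EFinP.
  by apply: (measurableT_comp (measurable_poisson_weight n.-1)).
- by move=> r; rewrite lee_fin poisson_weight_ge0.
Qed.

Lemma poisson_tail_nondecreasing :
  {homo poisson_tail lam n : u v / u <= v >-> (u <= v)%E}.
Proof.
move=> u v uv; have [u0|u0] := leP 0 u; last first.
  have uE : poisson_tail lam n u = poisson_tail lam n 0.
    by rewrite !poisson_tailE !(cumulative_rate_le0 lam)// ltW.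
  rewrite uE poisson_tail_integral// set_itv1 integral_set1.
  exact: poisson_tail_ge0.
rewrite !poisson_tail_integral//; last exact: le_trans uv.
apply: ge0_subset_integral => //=.
- apply/measurable_EFinP; apply: measurable_funS measurable_tail_density => //.
  by move=> x /=; rewrite !in_itv/= => /andP[->].
- by move=> x; rewrite in_itv/= => /andP[x0 _]; rewrite lee_fin tail_density_ge0.
- by move=> x /=; rewrite !in_itv/= => /andP[-> /le_trans]; apply.
Qed.

(** A nondecreasing function has a limit at infinity, which is identified along
    the integers. *)
Lemma cvg_poisson_tail : poisson_tail lam n u @[u --> +oo] -->
  (\int[mu]_(s in `[0%R, +oo[) (tail_density s)%:E)%E.
Proof.
have cL := nondecreasing_cvge poisson_tail_nondecreasing.
have cseq : poisson_tail lam n k%:R @[k --> \oo] -->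
    (\int[mu]_(s in `[0%R, +oo[) (tail_density s)%:E)%E.
  rewrite (_ : (fun k => _) = (fun k : nat =>
      \int[mu]_(s in `[0%R, k%:R]) (tail_density s)%:E)%E); last first.
    by apply/funext => k; rewrite poisson_tail_integral.
  have -> : `[0%R, +oo[%classic = \bigcup_(k : nat) `[0%R, k%:R]%classic :> set R.
    apply/seteqP; split => x /=; last first.
      by move=> [k _] /=; rewrite !in_itv/= => /andP[->].
    rewrite in_itv/= andbT => x0; exists (Num.bound x) => //=.
    by rewrite in_itv/= x0 ltW// archi_boundP.
  apply: ge0_nondecreasing_set_cvg_integral => //.
  - move=> i j ij; rewrite subsetEset => x /=; rewrite !in_itv/= => /andP[->/=].
    by move=> /le_trans; apply; rewrite ler_nat.
  - move=> k; apply/measurable_EFinP; apply: measurable_funS measurable_tail_density => //.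
    by move=> x /=; rewrite !in_itv/= => /andP[->].
  - move=> k x /=; rewrite in_itv/= => /andP[x0 _].
    by rewrite lee_fin tail_density_ge0.
have cL' : poisson_tail lam n k%:R @[k --> \oo] -->
    ereal_sup (range (poisson_tail lam n)).
  apply: cvg_comp cL; exact: cvgr_idn.
by rewrite -(cvg_unique _ cL' cseq).
Qed.

Lemma integral_tail_density_fin :
  (\int[mu]_(s in `[0%R, +oo[) (tail_density s)%:E)%E \is a fin_num.
Proof.
rewrite ge0_fin_numE; last first.
  apply: integral_ge0 => s; rewrite /= in_itv/= andbT => s0.
  by rewrite lee_fin tail_density_ge0.
apply: (@le_lt_trans _ _ 1%E); last by rewrite ltry.
rewrite -(cvg_lim (@ereal_hausdorff R) cvg_poisson_tail).
apply: lime_le; first by apply/cvg_ex; eexists; exact: cvg_poisson_tail.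
apply: nearW => u; rewrite poisson_tailE lee_fin lerBlDr lerDl.
apply: sumr_ge0 => k _; rewrite poisson_weight_ge0//.
exact: cumulative_rate_ge0.
Qed.

Lemma cvg_poisson_tail1 : Lam u @[u --> +oo] --> +oo ->
  poisson_tail lam n u @[u --> +oo] --> 1%E.
Proof.
move=> Ly; rewrite (_ : poisson_tail lam n =
  EFin \o (fun u => 1 - \sum_(0 <= k < n) poisson_weight (Lam u) k)); last first.
  by apply/funext => u; rewrite poisson_tailE.
apply: cvg_EFin; first exact: nearW.
rewrite -[X in _ --> X](subr0 1); apply: cvgB; first exact: cvg_cst.
elim: (n) => [|m ih].
  by under eq_fun do rewrite big_geq//; exact: cvg_cst.
have -> : (fun u => \sum_(0 <= k < m.+1) poisson_weight (Lam u) k) =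
    (fun u => \sum_(0 <= k < m) poisson_weight (Lam u) k +
              poisson_weight (Lam u) m).
  by apply/funext => u; rewrite big_nat_recr.
rewrite -[X in _ --> X](addr0 0); apply: cvgD; first exact: ih.
exact: (cvg_comp _ _ Ly (cvg_poisson_weighty m)).
Qed.

Lemma poisson_tail_complement y : 0 <= y ->
  (\int[mu]_(s in `[0%R, +oo[) (tail_density s)%:E =
   poisson_tail lam n y + \int[mu]_(s in `[y, +oo[) (tail_density s)%:E)%E.
Proof.
move=> y0; rewrite poisson_tail_integral//.
have mS (D : set R) : measurable D -> D `<=` `[0%R, +oo[%classic ->
    measurable_fun D (fun s => (tail_density s)%:E).
  by move=> mD sub; apply/measurable_EFinP; apply: measurable_funS measurable_tail_density.
rewrite -(@integral_itv_obnd_cbnd _ y); last first.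
  by apply: mS => // x /=; rewrite !in_itv/= !andbT; lra.
have -> : `[0%R, +oo[%classic = (`[0%R, y] `|` `]y, +oo[)%classic :> set R.
  apply/seteqP; split => x /=; rewrite !in_itv/= !andbT.
    by move=> x0; have [xy|yx] := leP x y; [left; rewrite x0|right].
  by case=> [/andP[]//|]; lra.
rewrite ge0_integral_setU//.
- apply: mS; first exact: measurableU.
  by move=> x /= []; rewrite !in_itv/= !andbT; [case/andP|lra].
- move=> x /= xy; rewrite lee_fin tail_density_ge0//; move: xy.
  by case; rewrite !in_itv/= ?andbT; [case/andP|lra].
- by apply/disj_setPS => x /= []; rewrite !in_itv/= andbT; lra.
Qed.

End poisson_tail.

(** * The fractional non-homogeneous Poisson process *)

Section fractional_process.
Context d (Omega : measurableType d) (R : realType) (P : probability Omega R).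
Variables (alpha : R) (lam : R -> R).
Variables (N1 : R -> {RV P >-> nat}) (L : R -> {RV P >-> R}).
Hypothesis hlam : intensity lam.
Hypothesis hN1 : unit_poisson_process N1.
Hypothesis hL : stable_subordinator alpha L.
Hypothesis hind : independent_processes P N1 (inverse_subordinator L).
Local Notation mu := (@lebesgue_measure R).
Local Notation Lam := (cumulative_rate lam).
Local Notation Y := (inverse_subordinator L).
Local Notation N := (fnpp lam N1 Y).

Let mN1 (t : R) : measurable_fun setT (N1 t). Proof. exact: measurable_funP. Qed.

Let N1mono w (s t : R) : 0 <= s -> s <= t -> (N1 s w <= N1 t w)%N.
Proof. exact: (poisson_nondecreasing hN1). Qed.

Let N1right w (t : R) : 0 <= t -> \forall s \near t^'+, N1 s w = N1 t w.
Proof. exact: (poisson_right_continuous hN1). Qed.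

Let mY (t : R) : measurable_fun setT (Y t).
Proof. exact: (measurable_inverse_stable_subordinator hL). Qed.

Let mLamY (t : R) : measurable_fun setT (fun w => Lam (Y t w)).
Proof. exact: (measurableT_comp (measurable_cumulative_rate hlam)). Qed.

Let LamY0 (t : R) w : 0 <= Lam (Y t w).
Proof. exact: cumulative_rate_ge0. Qed.

Lemma measurable_fnpp_ge (t : R) n : measurable [set w | (n <= N t w)%N].
Proof. exact: (measurable_path_at mN1 N1mono N1right). Qed.

Lemma measurable_fnpp_eq (t : R) n : measurable [set w | N t w = n].
Proof. exact: (measurable_path_at_eq mN1 N1mono N1right). Qed.

Lemma probability_ge_series (X : Omega -> nat) n :
  (forall k, measurable [set w | X w = k]) ->
  P [set w | (n <= X w)%N] = (\sum_(n <= k <oo) P [set w | X w = k])%E.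
Proof.
move=> mX; rewrite (_ : [set w | _] =
    \bigcup_(k in [set k | (n <= k)%N]) [set w | X w = k]); last first.
  apply/seteqP; split => w /=; first by move=> nX; exists (X w).
  by move=> [k /= nk ->].
rewrite measure_bigcup//; last by move=> i j _ _ [w [/= <- <-]].
rewrite [RHS]eseries_cond; apply: eq_eseriesl => k.
by rewrite /= mem_setE.
Qed.

(** The increment of N1 between 0 and [Lam u] is a Poisson variable. *)
Lemma poisson_tail_probability n (u : R) :
  P [set w | (n <= N1 (Lam u) w)%N] = poisson_tail lam n u.
Proof.
rewrite probability_ge_series; last first.
  by move=> k; exact: (measurable_preimageT (mN1 (Lam u)) (A := [set k])).
apply: eq_eseriesr => k _.
rewrite -[in RHS](subr0 (Lam u)) -(poisson_increment_law hN1)//; last first.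
  exact: cumulative_rate_ge0.
by congr (P _); apply/seteqP; split => w /=; rewrite (poisson_start hN1) subn0.
Qed.

Lemma fnpp_tail_probability n (t : R) : 0 <= t ->
  P [set w | (n <= N t w)%N] = (\int[P]_w poisson_tail lam n (Y t w))%E.
Proof.
move=> t0.
have -> : P [set w | (n <= N t w)%N] =
    (\int[P]_w P [set v | (n <= N1 (Lam (Y t w)) v)%N])%E.
  apply: (path_at_independent_time mN1 N1mono N1right (V := fun w => Lam (Y t w))) => //.
  move=> r B r0 mB.
  have mLB : measurable (Lam @^-1` B).
    exact: (measurable_preimageT (measurable_cumulative_rate hlam) mB).
  have := @hind 1%N 1%N (fun=> r) (fun=> t)
    (fun=> [set j | (n <= j)%N]) (fun=> Lam @^-1` B)
    (fun=> r0) (fun=> t0) (fun=> Logic.I) (fun=> mLB).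
  have b1 (F : nat -> set Omega) : \bigcap_(i in `I_1) F i = F 0%N.
    apply/seteqP; split => w /=; first by apply.
    by move=> F0 [|i].
  by rewrite !b1.
by apply: eq_integral => w _; exact: poisson_tail_probability.
Qed.

(** On regular paths [Y 0 = Y (L 0) = 0]. *)
Lemma fnpp_start n : 0 < alpha -> (0 < n)%N -> P [set w | (n <= N 0 w)%N] = 0%E.
Proof.
move=> a0 n0; apply/negligibleP; first exact: measurable_fnpp_ge.
have := ae_regular_paths a0 hN1 hL; apply: negligibleS => w /= nN reg.
move: nN; rewrite /fnpp -[in Y _](subordinator_start hL w).
rewrite (inverse_subordinatorK (N1 := N1)) ?cumulative_rate_le0//.
by rewrite (poisson_start hN1) leqNgt n0.
Qed.

Section arrival.
Variable n : nat.
Hypothesis n0 : (0 < n)%N.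
Let dens := tail_density lam n.

(** The integral over the outcomes of
    C = Q (Y t) + (the integral of the density over [Y t, oo[).  The integrals
    in the last term are exchanged on the product of the half-line with the
    probability space, where its domain is the set Y t <= u. *)
Lemma fnpp_tail_by_parts (t : R) : 0 <= t ->
  (\int[mu]_(u in `[0%R, +oo[) (P [set w | (Y t w <= u)%R] * (dens u)%:E) +
   P [set w | (n <= N t w)%N] = \int[mu]_(s in `[0%R, +oo[) (dens s)%:E)%E.
Proof.
move=> t0.
pose dens0 := dens \_ `[0%R, +oo[.
have d0 u : 0 <= dens0 u.
  rewrite /dens0 patchE; case: ifPn => //; rewrite inE/= in_itv/= andbT => u0.
  exact: tail_density_ge0.
have md0 : measurable_fun setT dens0.
  apply/(measurable_restrictT _ _).1 => //; exact: measurable_tail_density.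
have mle u : measurable [set w | Y t w <= u] by exact: measurable_le_set.
pose f (p : R * Omega) : \bar R := (((Y t p.2 <= p.1)%R%:R : R) * dens0 p.1)%:E.
have mf : measurable_fun setT f.
  apply/measurable_EFinP; apply: measurable_funM.
    apply: measurable_natr_bool.
    rewrite (_ : [set p | _] = [set p : R * Omega | Y t p.2 - p.1 <= 0]).
      apply: measurable_le_set; apply: measurable_funB => //.
      exact: (measurableT_comp (mY t)).
    by apply/seteqP; split => p /=; rewrite subr_le0.
  exact: (measurableT_comp md0).
have f0 p : (0 <= f p)%E by rewrite lee_fin mulr_ge0.
have -> : (\int[mu]_(u in `[0%R, +oo[) (P [set w | (Y t w <= u)%R] * (dens u)%:E) =
    \int[mu]_u \int[P]_w f (u, w))%E.
  rewrite integral_mkcond; apply: eq_integral => u _.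
  transitivity (P [set w | (Y t w <= u)%R] * (dens0 u)%:E)%E.
    by rewrite /dens0 !patchE; case: ifPn => _//; rewrite mule0.
  rewrite probability_integral_bool// -ge0_integralZr//.
  - by apply/measurable_EFinP; exact: measurable_natr_bool.
  - by rewrite lee_fin.
rewrite fubini_tonelli//.
have inner w : (\int[mu]_u f (u, w) = \int[mu]_(u in `[Y t w, +oo[) (dens u)%:E)%E.
  rewrite [RHS]integral_mkcond; apply: eq_integral => u _.
  rewrite /f/= patchE mem_setE in_itv/= andbT; case: ifPn => Yu.
    rewrite mul1r /dens0 patchE mem_setE in_itv/= andbT ifT//.
    exact: le_trans (inverse_subordinator_ge0 _ _ _) Yu.
  by rewrite mul0r.
under eq_integral do rewrite inner.
rewrite fnpp_tail_probability// -ge0_integralD//; last 4 first.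
- move=> w _; apply: integral_ge0 => s /=; rewrite in_itv/= andbT => Ys.
  rewrite lee_fin tail_density_ge0//.
  exact: le_trans (inverse_subordinator_ge0 _ _ _) Ys.
- under eq_fun do rewrite -inner.
  exact: measurable_fun_fubini_tonelli_G.
- by move=> w _; exact: poisson_tail_ge0.
- exact: (measurableT_comp (measurable_poisson_tail _ hlam)).
under eq_integral => w _.
  rewrite addeC -poisson_tail_complement//; last exact: inverse_subordinator_ge0.
  over.
rewrite integral_cst// -[RHS]mule1; congr (_ * _)%E; exact: probability_setT.
Qed.

Let T := arrival_time N n.

Lemma measurable_arrival_time_le (t : R) : 0 <= t ->
  measurable [set w | (T w <= t%:E)%E].
Proof.
move=> t0; rewrite (_ : [set w | _] = [set w | N t w = n] `|`
    \bigcup_(q : rat) [set w | [/\ 0 <= (ratr q : R), ratr q <= t &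
      N (ratr q) w = n]]).
  apply: measurableU; first exact: measurable_fnpp_eq.
  apply: bigcupT_measurable_rat => q.
  have [[q0 qt]|h] := pselect (0 <= (ratr q : R) /\ (ratr q : R) <= t).
    rewrite (_ : [set w | _] = [set w | N (ratr q) w = n]).
      exact: measurable_fnpp_eq.
    by apply/seteqP; split => w /= => [[]|].
  rewrite (_ : [set w | _] = set0)//.
  by apply/seteqP; split => // w /= [q0 qt _]; apply: h.
have TE w : (T w <= t%:E)%E <-> N t w = n \/ exists q : rat,
    [/\ 0 <= (ratr q : R), ratr q <= t & N (ratr q) w = n].
  apply: arrival_time_rat => //.
  - exact: (poisson_start hN1).
  - by move=> s; exact: N1right.
  - exact: cumulative_rate_le0.
  - exact: cumulative_rate_nondecreasing.
  - exact: continuous_cumulative_rate.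
apply/seteqP; split => w /=.
  by move=> /TE[|[q h]]; [left|right; exists q].
by move=> [Nt|[q _ h]]; apply/TE; [left|right; exists q].
Qed.

Lemma arrival_time_regular_paths w (t : R) : regular_paths N1 L w -> 0 <= t ->
  (T w <= t%:E)%E = (n <= N t w)%N.
Proof.
move=> reg t0; apply: arrival_time_regular => //.
- exact: (subordinator_nondecreasing hL).
- exact: (poisson_start hN1).
- exact: N1mono.
- by move=> s; exact: N1right.
- exact: cumulative_rate_le0.
- exact: cumulative_rate_nondecreasing.
- exact: continuous_cumulative_rate.
- exact: (subordinator_start hL).
Qed.

(** The two events agree on regular paths. *)
Lemma probability_arrival_time (t : R) : 0 < alpha -> 0 <= t ->
  P [set w | (T w <= t%:E)%E] = P [set w | (n <= N t w)%N].
Proof.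
move=> a0 t0; have mT := measurable_arrival_time_le t0.
have mN := measurable_fnpp_ge t n.
rewrite !probability_integral_bool//; apply: ae_eq_integral => //.
- by apply/measurable_EFinP; exact: measurable_natr_bool.
- by apply/measurable_EFinP; exact: measurable_natr_bool.
- apply: filterS (ae_regular_paths a0 hN1 hL) => w reg _.
  by rewrite arrival_time_regular_paths.
Qed.

End arrival.

End fractional_process.

Theorem mainTheorem6 (d : measure_display) (Omega : measurableType d)
    (R : realType) (P : probability Omega R)
    (alpha : R) (lam : R -> R) (g : R -> R)
    (N1 : R -> {RV P >-> nat}) (L : R -> {RV P >-> R}) (n : nat)
    (halpha : 0 < alpha < 1)
    (hlam : intensity lam)
    (hN1 : unit_poisson_process N1)
    (hL : stable_subordinator alpha L)
    (hg : is_density_of (L 1) g)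
    (hind : independent_processes P N1 (inverse_subordinator L))
    (hn : (0 < n)%N) :
  let Lambda := cumulative_rate lam in
  let N := fnpp lam N1 (inverse_subordinator L) in
  let T := arrival_time N n in
  let h := inverse_density alpha g in
  let f (x : nat) (t : R) := P [set w | N t w = x] in
  [/\ (\forall w \ae P, regular_paths N1 L w) /\
      (forall w, regular_paths N1 L w -> forall t : R, 0 <= t ->
         (T w <= t%:E)%E = (n <= N t w)%N),
      forall t : R, 0 <= t ->
        [/\ measurable [set w | (T w <= t%:E)%E],
            P [set w | (T w <= t%:E)%E] = P [set w | (n <= N t w)%N],
            P [set w | (n <= N t w)%N] = (\sum_(n <= x <oo) f x t)%E
          & (\sum_(n <= x <oo) f x t =
             \int[lebesgue_measure]_(u in `[0%R, +oo[)
               ((h t u)%:E * poisson_tail lam n u))%E]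
    & exists C : R,
        [/\ poisson_tail lam n u @[u --> +oo] --> C%:E,
            Lambda u @[u --> +oo] --> +oo -> C = 1
          & forall t : R, 0 < t ->
              (P [set w | T w <= t%:E] =
               C%:E - \int[lebesgue_measure]_(u in `[0%R, +oo[)
                 ((\int[lebesgue_measure]_(v in `[0%R, u]) (h t v)%:E) *
                  (lam u * expR (- Lambda u) * Lambda u ^+ n.-1
                     / (n.-1)`!%:R)%:E))%E]].
Proof.
move=> Lambda N T h f; have /andP[a0 _] := halpha.
have fE (t : R) : P [set w | (n <= N t w)%N] = (\sum_(n <= x <oo) f x t)%E.
  apply: probability_ge_series => k.
  exact: (measurable_fnpp_eq hlam hN1 hL).
have tailE (t : R) : 0 < t -> P [set w | (n <= N t w)%N] =
    (\int[lebesgue_measure]_(u in `[0%R, +oo[)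
      ((h t u)%:E * poisson_tail lam n u))%E.
  move=> t0; rewrite (fnpp_tail_probability hlam hN1 hL hind)// ?(ltW t0)//.
  apply: (expectation_inverse_subordinator halpha hL hg) => //.
    exact: measurable_poisson_tail.
  exact: poisson_tail_ge0.
split.
- split; first exact: (ae_regular_paths a0 hN1 hL).
  by move=> w reg t; exact: (arrival_time_regular_paths hlam hN1 hL hn).
- move=> t t0; split.
  + exact: (measurable_arrival_time_le hlam hN1 hL hn).
  + exact: (probability_arrival_time hlam hN1 hL hn).
  + exact: fE.
  + rewrite -fE; move: t0; rewrite le_eqVlt => /predU1P[<-|]; last exact: tailE.
    rewrite (fnpp_start hlam hN1 hL)// integral0_eq// => u _.
    by rewrite /h /inverse_density !mul0r mul0e.
- have Cfin := integral_tail_density_fin hlam hn.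
  have cC := cvg_poisson_tail hlam hn.
  exists (fine (\int[lebesgue_measure]_(s in `[0%R, +oo[)
    (tail_density lam n s)%:E)%E); rewrite fineK//; split => //.
    move=> Ly; have c1 := cvg_poisson_tail1 n hlam Ly.
    by rewrite (cvg_unique _ cC c1).
  move=> t t0; rewrite (probability_arrival_time hlam hN1 hL hn a0 (ltW t0)).
  have -> : (\int[lebesgue_measure]_(u in `[0%R, +oo[)
      ((\int[lebesgue_measure]_(v in `[0%R, u]) (h t v)%:E) *
       (lam u * expR (- Lambda u) * Lambda u ^+ n.-1 / (n.-1)`!%:R)%:E) =
    \int[lebesgue_measure]_(u in `[0%R, +oo[)
      (P [set w | (inverse_subordinator L t w <= u)%R] *
       (tail_density lam n u)%:E))%E.
    apply: eq_integral => u; rewrite inE/= in_itv/= andbT => u0.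
    by rewrite (inverse_subordinator_cdf_density halpha hL hg).
  have := Cfin.
  rewrite -(fnpp_tail_by_parts hlam hN1 hL hind hn (ltW t0)).
  by rewrite fin_numD => /andP[Ifin _]; rewrite addeAC subee// add0e.
Qed.
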